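(* For all positive integers $n$ and $w$, every matroid of branch-depth at least $3(3w)^{2n}$ contains a minor isomorphic to $M(F_n)$ or has branch-width more than $w$.
   Context: All matroids are finite. For a matroid $M$ with rank function $r$, the connectivity function is $\lambda_M(X)=r(X)+r(E(M)\setminus X)-r(E(M))$ for $X\subseteq E(M)$. Branch-depth: A decomposition of $M$ is a pair $(T,\sigma)$ consisting of a tree $T$ with at least one internal (non-leaf) node and a bijection $\sigma$ from $E(M)$ to the set of leaves of $T$. For an internal node $v$ of $T$, let $\mathcal{P}_v$ be the partition of $E(M)$ into the sets induced, under $\sigma^{-1}$, by the components of $T-v$; the width of $v$ is $\max_{\mathcal{P}'\subseteq\mathcal{P}_v}\lambda_M\big(\bigcup_{X\in\mathcal{P}'}X\big)$. The width of $(T,\sigma)$ is the maximum width of its internal nodes; its radius is the radius of $T$. A $(k,r)$-decomposition is a decomposition of width at most $k$ and radius at most $r$. The branch-depth of $M$ is the minimum integer $k$ such that $M$ admits a $(k,k)$-decomposition if $|E(M)|>1$, and is $0$ otherwise. Branch-width: A subcubic tree is a tree in which every node has degree $1$ or $3$. A branch-decomposition of $M$ is a pair $(T,\sigma)$ of a subcubic tree $T$ and a bijection $\sigma$ from $E(M)$ to the leaves of $T$. The width of an edge $e$ of $T$ is $\lambda_M(A_e)+1$, where $(A_e,B_e)$ is the partition of $E(M)$ induced by the components of $T\setminus e$ under $\sigma^{-1}$. The width of $(T,\sigma)$ is the maximum width of an edge of $T$. The branch-width of $M$ is the minimum width of a branch-decomposition of $M$ if $|E(M)|>1$, and is $1$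 otherwise. Fan: $F_n$ is the graph that is the union of a star $K_{1,n}$ and a path with $n$ vertices through the leaves of the star; $M(F_n)$ is its cycle matroid. *)

(* Defs.v *)
From mathcomp Require Import all_boot.
From mathcomp Require Import boolp.

Set Implicit Arguments.
Unset Strict Implicit.
Unset Printing Implicit Defensive.

(* The definition is total (value 0 when no integer satisfies P); minima below
   are shown to be attained: see leastP, dist_attained, radius_attained,
   branch_depth_attained and branch_width_attained. *)
Definition least (P : nat -> Prop) : nat :=
  if pselect (exists k, `[< P k >]) is left e then ex_minn e else 0.

Lemma leastP (P : nat -> Prop) :
  (exists k, P k) -> P (least P) /\ forall k, P k -> least P <= k.
Proof.
move=> [k Pk]; rewrite /least; case: pselect => [e|[]].
  case: ex_minnP => m /asboolP Pm min_m; split=> // j /asboolP; exact: min_m.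
by exists k; apply/asboolP.
Qed.

(* The ground set is a subset of an ambient finite type, so that a minor of M
   lives over the same type as M. *)
Record matroid (T : finType) := Matroid {
  ground : {set T};
  indep : pred {set T};
  indep_ground : forall I : {set T}, indep I -> I \subset ground;
  indep0 : indep set0;
  indepS : forall I J : {set T}, J \subset I -> indep I -> indep J;
  indep_augment : forall I J : {set T}, indep I -> indep J -> #|I| < #|J| ->
    exists2 x, x \in J :\: I & indep (x |: I) }.

Section MatroidTheory.
Variables (T : finType) (M : matroid T).
Implicit Types (I J B X Y C D : {set T}).

Definition rank X : nat := \max_(I : {set T} | (I \subset X) && indep M I) #|I|.

Lemma leq_rank I X : I \subset X -> indep M I -> #|I| <= rank X.
Proof. by move=> sIX iI; apply: leq_bigmax_cond; rewrite sIX. Qed.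

Lemma rank_leP X m :
  reflect (forall I, I \subset X -> indep M I -> #|I| <= m) (rank X <= m).
Proof.
apply: (iffP (bigmax_leqP _ _ _)) => H I; last by case/andP; apply: H.
by move=> sIX iI; apply: H; rewrite sIX.
Qed.

Lemma rankS X Y : X \subset Y -> rank X <= rank Y.
Proof.
move=> sXY; apply/rank_leP => I sIX; apply: leq_rank.
exact: subset_trans sIX sXY.
Qed.

Lemma rank_basis I X : I \subset X -> indep M I ->
  exists B, [/\ I \subset B, B \subset X, indep M B & #|B| = rank X].
Proof.
move=> sIX iI; have [n] := ubnP (rank X - #|I|).
elim: n I sIX iI => // n IHn I sIX iI.
rewrite ltnS => len.
have := leq_rank sIX iI; rewrite leq_eqVlt => /orP[/eqP eqI|ltI].
  by exists I.
have [|J /andP[sJX iJ] eqJ] := @eq_bigmax_cond _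
    [pred I : {set T} | (I \subset X) && indep M I] (fun I => #|I|).
  by apply/card_gt0P; exists I; rewrite inE sIX.
have ltIJ : #|I| < #|J| by rewrite -eqJ.
have [x /setDP[xJ xnI] iIx] := indep_augment iI iJ ltIJ.
have [|//||B [sB ? ? ?]] := IHn (x |: I).
- by rewrite subUset sub1set (subsetP sJX).
- by rewrite cardsU1 xnI (leq_trans _ len)// ltn_sub2l.
by exists B; split=> //; apply: subset_trans sB; apply: subsetUr.
Qed.

(* Truncated subtraction is harmless here by leq_rank_ground. *)
Definition lambda X : nat :=
  rank X + rank (ground M :\: X) - rank (ground M).

Lemma leq_rank_ground X :
  rank (ground M) <= rank X + rank (ground M :\: X).
Proof.
apply/rank_leP => I sI iI; rewrite -(cardsID X I) leq_add// leq_rank//.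
- exact: subsetIr.
- by apply: indepS iI; apply: subsetIl.
- exact: setSD.
- by apply: indepS iI; apply: subsetDl.
Qed.

Section Deletion.
Variable D : {set T}.

Definition delete_indep : pred {set T} :=
  [pred I : {set T} | indep M I && [disjoint I & D]].

Lemma delete_ground I : delete_indep I -> I \subset ground M :\: D.
Proof. by case/andP=> /indep_ground sI dI; rewrite subsetD sI. Qed.

Lemma delete_indep0 : delete_indep set0.
Proof. by rewrite /delete_indep /= indep0 disjoints_subset sub0set. Qed.

Lemma delete_indepS I J : J \subset I -> delete_indep I -> delete_indep J.
Proof.
by move=> sJI /andP[iI dI]; rewrite /delete_indep /= (indepS sJI iI) (disjointWl sJI).
Qed.

Lemma delete_augment I J : delete_indep I -> delete_indep J -> #|I| < #|J| ->
  exists2 x, x \in J :\: I & delete_indep (x |: I).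
Proof.
move=> /andP[iI dI] /andP[iJ dJ] /(indep_augment iI iJ)[x xJI iIx].
exists x => //; rewrite /delete_indep /= iIx disjoints_subset.
rewrite subUset sub1set -disjoints_subset dI inE andbT.
by case/setDP: xJI => xJ _; rewrite (disjointFr dJ xJ).
Qed.

Definition delete : matroid T :=
  Matroid delete_ground delete_indep0 delete_indepS delete_augment.
End Deletion.

Section Contraction.
Variable C : {set T}.

(* I is independent in M / C iff r_{M/C}(I) = r(I :|: C) - r(C) equals |I|. *)
Definition contract_indep : pred {set T} :=
  [pred I : {set T} | (I \subset ground M :\: C) && (rank (I :|: C) == rank C + #|I|)].

Lemma contract_indepE B I : B \subset C -> indep M B -> #|B| = rank C ->
  contract_indep I = (I \subset ground M :\: C) && indep M (B :|: I).
Proof.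
move=> sBC iB rB; rewrite /contract_indep /=; case: (boolP (_ \subset _)) => //= sI.
have dIC : [disjoint I & C] by move: sI; rewrite subsetD => /andP[].
have cBI : #|B :|: I| = #|B| + #|I|.
  rewrite cardsU (_ : B :&: I = set0) ?cards0 ?subn0//.
  by apply/setP=> x; rewrite !inE; apply/andP=> -[/(subsetP sBC) xC];
    apply/negP; rewrite (disjointFl dIC).
have sBIC : B :|: I \subset I :|: C.
  by rewrite setUC setUS.
have rle : rank (I :|: C) <= rank C + #|I|.
  apply/rank_leP => J sJ iJ; rewrite -(cardsID C J) leq_add//.
    by rewrite leq_rank ?subsetIr//; apply: indepS iJ; apply: subsetIl.
  by rewrite subset_leq_card// subDset setUC.
apply/eqP/idP => [rI|iBI]; last first.
  by apply/eqP; rewrite eqn_leq rle -rB -cBI leq_rank.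
have [||K [sBK sK iK rK]] := @rank_basis B (I :|: C) => //.
  by apply: subset_trans sBC _; apply: subsetUr.
have KC : #|K :&: C| <= rank C.
  by rewrite leq_rank ?subsetIr//; apply: indepS iK; apply: subsetIl.
have KCB : K :&: C = B.
  by apply/esym/eqP; rewrite eqEcard rB KC subsetI sBK sBC.
have KDI : K :\: C \subset I by rewrite subDset setUC.
have : K :\: C = I.
  apply/eqP; rewrite eqEcard KDI /=.
  by rewrite -(leq_add2l #|B|) -{2}KCB cardsID rK rI rB.
by move=> KD; rewrite -KD -KCB setID.
Qed.

Lemma contract_basis : exists B, [/\ B \subset C, indep M B & #|B| = rank C].
Proof.
by have [B [_ ? ? ?]] := rank_basis (sub0set C) (indep0 M); exists B.
Qed.

Lemma contract_ground I : contract_indep I -> I \subset ground M :\: C.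
Proof. by case/andP. Qed.

Lemma contract_indep0 : contract_indep set0.
Proof. by rewrite /contract_indep /= sub0set set0U cards0 addn0 /=. Qed.

Lemma contract_indepS I J :
  J \subset I -> contract_indep I -> contract_indep J.
Proof.
have [B [sB iB rB]] := contract_basis; rewrite !(contract_indepE _ sB iB rB).
move=> sJI /andP[sI iI]; rewrite (subset_trans sJI sI) /=.
by apply: indepS iI; apply: setUS.
Qed.

Lemma contract_augment I J :
  contract_indep I -> contract_indep J -> #|I| < #|J| ->
  exists2 x, x \in J :\: I & contract_indep (x |: I).
Proof.
have [B [sB iB rB]] := contract_basis; rewrite !(contract_indepE _ sB iB rB).
have cU (K : {set T}) : K \subset ground M :\: C -> #|B :|: K| = #|B| + #|K|.
  rewrite subsetD => /andP[_ dKC]; rewrite cardsU.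
  rewrite (_ : B :&: K = set0) ?cards0 ?subn0//.
  by apply/setP=> x; rewrite !inE; apply/andP=> -[/(subsetP sB) xC];
    apply/negP; rewrite (disjointFl dKC).
move=> /andP[sI iI] /andP[sJ iJ] ltIJ.
have [|x] := indep_augment iI iJ; first by rewrite !cU// ltn_add2l.
rewrite !inE negb_or => /andP[/andP[xnB xnI]]; rewrite (negPf xnB) /= => xJ ix.
exists x; first by rewrite !inE xnI.
rewrite (contract_indepE _ sB iB rB) setUCA ix andbT.
by rewrite subUset sub1set sI (subsetP sJ).
Qed.

Definition contract : matroid T :=
  Matroid contract_ground contract_indep0 contract_indepS contract_augment.
End Contraction.

End MatroidTheory.

Definition matroid_iso (T U : finType) (M : matroid T) (N : matroid U) : Prop :=
  exists f : T -> U,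
    [/\ {in ground M &, injective f}, f @: ground M = ground N &
        forall I : {set T}, I \subset ground M -> indep N (f @: I) = indep M I].

Definition has_minor (T U : finType) (M : matroid T) (N : matroid U) : Prop :=
  exists C D : {set T},
    [/\ C \subset ground M, D \subset ground M, [disjoint C & D] &
        matroid_iso (delete (contract M C) D) N].

Record sgraph := SGraph {
  vertex :> finType;
  adj : rel vertex;
  adj_sym : symmetric adj;
  adj_irr : irreflexive adj }.

(* For a symmetric e, a walk x - y - x along a single edge is a ucycle of
   size 2; the cycles of a simple graph are the ucycles of size at least 3. *)
Definition acyclic (V : finType) (e : rel V) : Prop :=
  forall c : seq V, ucycle e c -> size c <= 2.

Section Graphs.
Variable G : sgraph.

Definition degree (x : G) : nat := #|[set y | adj x y]|.

Definition leaf (x : G) : bool := degree x == 1.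

Definition is_tree : Prop :=
  [/\ 0 < #|G|, forall x y : G, connect (@adj G) x y & acyclic (@adj G)].

Definition dist (x y : G) : nat :=
  least (fun k => exists p : seq G, [/\ path (@adj G) x p, last x p = y & size p = k]).

Lemma dist_attained (x y : G) : connect (@adj G) x y ->
  exists p : seq G, [/\ path (@adj G) x p, last x p = y & size p = dist x y].
Proof.
move/connectP=> [p pth lst]; rewrite /dist; set P := (P in least P).
by case: (@leastP P) => //; exists (size p), p.
Qed.

Definition radius : nat :=
  least (fun r => exists x : G, forall y : G, dist x y <= r).

Lemma radius_attained : 0 < #|G| ->
  exists x : G, forall y : G, dist x y <= radius.
Proof.
case/card_gt0P => x _; rewrite /radius; set P := (P in least P).
case: (@leastP P) => //; exists (\max_y dist x y), x => y; exact: leq_bigmax_cond.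
Qed.

Definition edges : {set {set G}} :=
  [set e : {set G} | [exists x, exists y, adj x y && (e == [set x; y])]].

Lemma edgesP e :
  reflect (exists x y, adj x y /\ e = [set x; y]) (e \in edges).
Proof.
rewrite inE; apply: (iffP existsP) => [[x /existsP[y /andP[a /eqP->]]]|].
  by exists x, y.
by move=> [x [y [a ->]]]; exists x; apply/existsP; exists y; rewrite a eqxx.
Qed.

End Graphs.

Section CycleMatroid.
Variable G : sgraph.
Implicit Types (X Y I J : {set {set G}}) (x y : G).

Definition spanning_adj X : rel G := [rel x y | [set x; y] \in X].

Definition forest X : bool := (X \subset edges G) && `[< acyclic (spanning_adj X) >].

Lemma spanning_sym X : symmetric (spanning_adj X).
Proof. by move=> x y; rewrite /spanning_adj /= setUC. Qed.

Lemma spanning_connect_sym X : connect_sym (spanning_adj X).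
Proof. by apply: sym_connect_sym; apply: spanning_sym. Qed.

Lemma spanning_sub X Y : X \subset Y -> subrel (spanning_adj X) (spanning_adj Y).
Proof. by move=> /subsetP sXY x y /= /sXY. Qed.

Lemma acyclic_sub (V : finType) (e e' : rel V) :
  subrel e e' -> acyclic e' -> acyclic e.
Proof.
move=> see' ac c /andP[cyc unq]; apply: ac.
by rewrite /ucycle unq (sub_cycle see').
Qed.

Lemma sub_source_path (V : eqType) (e e' : rel V) (P : pred V) a q :
  (forall u v, P u -> e u v -> e' u v) ->
  all P (belast a q) -> path e a q -> path e' a q.
Proof.
move=> see'; elim: q a => //= b q IHq a /andP[Pa Pq] /andP[eab pq].
by rewrite (see' _ _ Pa eab) IHq.
Qed.

Lemma acyclic_add X x y :
  acyclic (spanning_adj X) -> ~~ connect (spanning_adj X) x y ->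
  acyclic (spanning_adj ([set x; y] |: X)).
Proof.
move=> acX ncxy c ucc; have /andP[cyc unq] := ucc.
rewrite leqNgt; apply/negP => gt2.
case: (boolP (all (fun u => spanning_adj X u (next c u)) c)) => [/allP allX|].
  suff : cycle (spanning_adj X) c.
    by move=> cX; have := acX c; rewrite /ucycle cX unq leqNgt gt2 => /(_ isT).
  apply: (@sub_in_cycle _ (mem c) (frel (next c))); last exact: cycle_next.
    by move=> u v uc _ /= /eqP <-; apply: allX.
  by apply/allP.
case/allPn => u uc nXu.
have [i p def_c] := rot_to uc.
have cu : cycle (spanning_adj ([set x; y] |: X)) (u :: p).
  by rewrite -def_c rot_cycle.
have unqp : uniq (u :: p) by rewrite -def_c rot_uniq.
have szp : 1 < size p by move: gt2; rewrite -(size_rot i) def_c.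
have nxt : next c u = head u p.
  by rewrite -(next_rot i unq) def_c; case: p {def_c cu unqp szp} => [|v p] /=;
    rewrite eqxx.
case: p def_c cu unqp szp nxt => [|v [|w p]] //= _ /and3P[euv evw pw] unqp _ nxt.
have {nXu} nXuv : [set u; v] \notin X by rewrite nxt in nXu.
have {euv} /eqP exy : [set u; v] == [set x; y].
  by move: euv; rewrite /spanning_adj /= !inE (negPf nXuv) orbF.
have step a b : a != u -> a != v ->
    spanning_adj ([set x; y] |: X) a b -> spanning_adj X a b.
  move=> au av; rewrite /spanning_adj /= -exy inE => /orP[|//] /set1P eq.
  have : a \in [set u; v] by rewrite -eq !inE eqxx.
  by rewrite !inE (negPf au) (negPf av).
have /and4P[] := unqp; rewrite !inE !negb_or => /and3P[uv uw up] /andP[vw vp] wp uq.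
have cvu : connect (spanning_adj X) v u.
  apply/connectP; exists (w :: rcons p u); last by rewrite /= last_rcons.
  rewrite /= (spanning_sym X v w) (step w v) ?[w == _]eq_sym//=; last first.
    by rewrite spanning_sym.
  apply: (@sub_source_path _ _ _ [pred a | (a != u) && (a != v)] _ _ _ _ pw).
    by move=> a b /andP[]; apply: step.
  rewrite belast_rcons /= ![w == _]eq_sym uw vw /=.
  apply/allP => a ap /=; apply/andP; split.
    by apply: contraNneq up => <-.
  by apply: contraNneq vp => <-.
have : x \in [set u; v] by rewrite exy !inE eqxx.
have : y \in [set u; v] by rewrite exy !inE eqxx orbT.
have cuv : connect (spanning_adj X) u v by rewrite spanning_connect_sym.
rewrite !inE => /orP[]/eqP ey /orP[]/eqP ex; move: ncxy; rewrite ex ey.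
- by rewrite connect0.
- by rewrite cvu.
- by rewrite cuv.
- by rewrite connect0.
Qed.

Lemma acyclic_bridge X x y :
  acyclic (spanning_adj X) -> x != y -> [set x; y] \in X ->
  ~~ connect (spanning_adj (X :\ [set x; y])) x y.
Proof.
move=> acX nxy eX; apply/negP => /connectP[p0 pth0].
case: (shortenP pth0) => p pth unq _ lst {p0 pth0}.
case: p pth unq lst => [|a [|b p]].
- by move=> _ _ /= eyx; rewrite eyx eqxx in nxy.
- move=> /= /andP[+ _] _ ay; rewrite /spanning_adj /= ay.
  by rewrite in_setD1 eqxx.
move=> pth unq lst; suff /acX : ucycle (spanning_adj X) [:: x, a, b & p] by [].
rewrite /ucycle unq andbT.
have pX : path (spanning_adj X) x [:: a, b & p].
  by apply: sub_path pth; apply/spanning_sub/subsetDl.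
rewrite (cycle_path x) /= in pX *; rewrite pX andbT -[last b p]/(last x [:: a, b & p]).
by rewrite -lst /spanning_adj /= setUC.
Qed.

Lemma edge_neq x y : [set x; y] \in edges G -> x != y.
Proof.
case/edgesP => u [v [auv exy]]; apply/negP => /eqP exy'; subst y.
have uv : u = v.
  have : u \in [set x; x] by rewrite exy !inE eqxx.
  have : v \in [set x; x] by rewrite exy !inE eqxx orbT.
  by rewrite !inE !orbb => /eqP -> /eqP.
by rewrite uv adj_irr in auv.
Qed.

Lemma path_cross (V : finType) (e f : rel V) (x y : V) :
  connect e x y -> ~~ connect f x y ->
  exists u v, e u v /\ ~~ connect f u v.
Proof.
case/connectP => p; elim: p x => [|a p IHp] x /=.
  by move=> _ ->; rewrite connect0.
move=> /andP[exa pth] lst nf.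
case: (boolP (connect f x a)) => [cxa|]; last by exists x, a.
apply: (IHp a pth lst); apply: contra nf; exact: connect_trans.
Qed.

Lemma forest_card I J : forest I -> forest J ->
  (forall x y, [set x; y] \in J -> connect (spanning_adj I) x y) ->
  #|J| <= #|I|.
Proof.
move=> fI fJ; have [n] := ubnP #|J :\: I|.
elim: n J fJ => // n IHn J fJ; rewrite ltnS => leJI JcI.
case: (set_0Vmem (J :\: I)) => [/eqP|[e]].
  by rewrite setD_eq0 => /subset_leq_card.
have [/andP[sI /asboolP aI] /andP[sJ /asboolP aJ]] := (fI, fJ).
rewrite inE => /andP[eI eJ].
have /edgesP[x [y [axy exy]]] := subsetP sJ _ eJ; subst e.
have nxy := edge_neq (subsetP sJ _ eJ).
have nc := acyclic_bridge aJ nxy eJ.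
have [u [v [euv ncuv]]] := path_cross (JcI _ _ eJ) nc.
have {}euv : [set u; v] \in I := euv.
have nuvJ : [set u; v] \notin J :\ [set x; y].
  by apply: contra ncuv => uvJ; apply: connect1.
have nuv : [set u; v] != [set x; y].
  by apply: contraNneq eI => <-.
have nJ : [set u; v] \notin J by move: nuvJ; rewrite !inE nuv.
pose J' := [set u; v] |: (J :\ [set x; y]).
have cJ' : #|J'| = #|J| by rewrite cardsU1 nuvJ (cardsD1 [set x; y] J) eJ.
rewrite -cJ'; apply: IHn.
- apply/andP; split.
    by rewrite subUset sub1set (subsetP sI) //= (subset_trans (subsetDl _ _)).
  apply/asboolP/acyclic_add => //.
  by apply: acyclic_sub aJ; apply/spanning_sub/subsetDl.
- apply: leq_trans leJI; apply: proper_card.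
  apply/properP; split.
    apply/subsetP => e; rewrite !inE => /andP[enI /orP[/eqP eE|/andP[_ ->]]].
      by rewrite eE euv in enI.
    by rewrite enI.
  exists [set x; y]; first by rewrite !inE eI eJ.
  by rewrite !inE eq_sym (negPf nuv) eqxx andbF.
- move=> a b; rewrite inE => /orP[/set1P eab|].
    by apply: connect1; rewrite /spanning_adj /= eab.
  by rewrite inE => /andP[_]; apply: JcI.
Qed.

Lemma forest_edges X : forest X -> X \subset edges G.
Proof. by case/andP. Qed.

Lemma forest0 : forest set0.
Proof.
rewrite /forest sub0set; apply/asboolP => -[|x [|y p]] //.
by rewrite /ucycle /spanning_adj /= in_set0.
Qed.

Lemma forestS I J : J \subset I -> forest I -> forest J.
Proof.
move=> sJI /andP[sI /asboolP aI]; rewrite /forest (subset_trans sJI sI) /=.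
by apply/asboolP; apply: acyclic_sub aI; apply: spanning_sub.
Qed.

Lemma forest_augment I J : forest I -> forest J -> #|I| < #|J| ->
  exists2 e, e \in J :\: I & forest (e |: I).
Proof.
move=> fI fJ ltIJ.
have [/existsP[e /andP[eJI fe]]|] :=
  boolP [exists e, (e \in J :\: I) && forest (e |: I)]; first by exists e.
rewrite negb_exists => /forallP none; move: ltIJ; rewrite ltnNge => /negP[].
apply: forest_card => // x y eJ.
case: (boolP ([set x; y] \in I)) => [eI|enI]; first exact: connect1.
have := none [set x; y]; rewrite inE enI eJ /=; apply: contraNT => nc.
have [/andP[sI /asboolP aI] /andP[sJ _]] := (fI, fJ).
rewrite /forest subUset sub1set sI (subsetP sJ) //=.
by apply/asboolP/acyclic_add.
Qed.

Definition cycle_matroid : matroid {set G} :=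
  Matroid forest_edges forest0 forestS forest_augment.

End CycleMatroid.

(* None is the centre of the star, and the Some a are its leaves. *)
Definition star_adj (A : finType) : rel (option A) :=
  [rel u v | isSome u != isSome v].

Definition path_adj (n : nat) : rel (option 'I_n) :=
  [rel u v : option 'I_n | if (u, v) is (Some i, Some j)
             then (j == i.+1 :> nat) || (i == j.+1 :> nat) else false].

Definition fan_adj (n : nat) : rel (option 'I_n) :=
  [rel u v | star_adj u v || path_adj u v].

Lemma fan_sym n : symmetric (@fan_adj n).
Proof. by case=> [i|] [j|] //; rewrite /fan_adj /path_adj /= orbC. Qed.

Lemma fan_irr n : irreflexive (@fan_adj n).
Proof.
case=> [i|] //; rewrite /fan_adj /path_adj /= orbb.
by apply/negbTE; rewrite neq_ltn ltnSn.
Qed.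

Definition fan (n : nat) : sgraph := SGraph (@fan_sym n) (@fan_irr n).

Section Decompositions.
Variables (T : finType) (M : matroid T).

Section Tree.
Variables (G : sgraph) (sigma : T -> G).

Definition leaf_bijection : Prop :=
  {in ground M &, injective sigma} /\ sigma @: ground M = [set x | leaf x].

Definition del_node (v : G) : rel G :=
  [rel x y | [&& x != v, y != v & adj x y]].

Definition del_edge (a b : G) : rel G :=
  [rel x y | adj x y && ([set x; y] != [set a; b])].

Definition component_preim (e : rel G) (x : G) : {set T} :=
  [set t in ground M | connect e x (sigma t)].

Definition node_partition (v : G) : {set {set T}} :=
  [set component_preim (del_node v) x | x in [set~ v]].

Definition node_width (v : G) : nat :=
  \max_(P : {set {set T}} | P \subset node_partition v) lambda M (cover P).

Definition is_decomposition : Prop :=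
  [/\ is_tree G, exists v : G, ~~ leaf v & leaf_bijection].

Definition decomposition_width : nat := \max_(v : G | ~~ leaf v) node_width v.

Definition is_branch_decomposition : Prop :=
  [/\ is_tree G, forall v : G, degree v = 1 \/ degree v = 3 & leaf_bijection].

Definition edge_width (a b : G) : nat :=
  (lambda M (component_preim (del_edge a b) a)).+1.

(* Each edge occurs as (a, b) and as (b, a), which yield the two sides A_e and
   B_e of the same partition and hence the same connectivity. *)
Definition branch_decomposition_width : nat :=
  \max_(ab : G * G | adj ab.1 ab.2) edge_width ab.1 ab.2.

End Tree.

Definition has_decomposition (k r : nat) : Prop :=
  exists (G : sgraph) (sigma : T -> G),
    [/\ is_decomposition sigma, decomposition_width sigma <= k & radius G <= r].

Definition branch_depth : nat :=
  if 1 < #|ground M| then least (fun k => has_decomposition k k) else 0.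

Definition branch_width : nat :=
  if 1 < #|ground M| then
    least (fun k => exists (G : sgraph) (sigma : T -> G),
             is_branch_decomposition sigma /\ branch_decomposition_width sigma = k)
  else 1.

End Decompositions.

Section Star.
Variable A : finType.

Lemma full_star_sym : symmetric (@star_adj A).
Proof. by move=> u v; rewrite /star_adj /= eq_sym. Qed.

Lemma full_star_irr : irreflexive (@star_adj A).
Proof. by move=> u; rewrite /star_adj /= eqxx. Qed.

Definition full_star : sgraph := SGraph full_star_sym full_star_irr.

Lemma full_star_tree : is_tree full_star.
Proof.
have cN (u : full_star) : connect (@adj full_star) u None.
  by case: u => [a|]; [apply: connect1 | apply: connect0].
split; first by apply/card_gt0P; exists None.
  move=> x y; apply: (connect_trans (cN x)).
  by rewrite sym_connect_sym //; apply: full_star_sym.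
by case=> [|[a|] [|[b|] [|[c|] [|[d|] p]]]] //=; rewrite /ucycle /= ?inE /= ?andbF ?orbT.
Qed.

Lemma full_star_leaf (u : full_star) : 1 < #|A| -> leaf u = isSome u.
Proof.
move=> A1; rewrite /leaf /degree; case: u => [a|] /=.
  apply/eqP; rewrite (_ : [set y | _] = [set None]) ?cards1//.
  by apply/setP => -[b|]; rewrite !inE.
rewrite (_ : [set y | _] = Some @: [set: A]); last first.
  apply/setP => -[b|]; rewrite !inE /=.
    by rewrite mem_imset ?inE//; apply: Some_inj.
  by apply/esym/imsetP => -[].
rewrite card_imset; last exact: Some_inj.
by rewrite cardsT; apply/negbTE; rewrite neq_ltn A1 orbT.
Qed.

End Star.

Lemma branch_depth_attained (T : finType) (M : matroid T) : 1 < #|ground M| ->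
  has_decomposition M (branch_depth M) (branch_depth M).
Proof.
move=> M1; rewrite /branch_depth M1.
suff: exists k, has_decomposition M k k by case/leastP.
pose A := {x : T | x \in ground M}.
have A1 : 1 < #|{: A}| by rewrite card_sig.
pose s : T -> full_star A := fun x => insub x.
have sE x : x \in ground M -> exists2 u : A, s x = Some u & val u = x.
  by move=> xM; rewrite /s; case: insubP => [u _ <-|/negP//]; exists u.
exists (maxn (decomposition_width M s) (radius (full_star A))).
exists (full_star A), s; rewrite leq_maxl leq_maxr; split=> //.
split; [exact: full_star_tree | by exists None; rewrite full_star_leaf |].
split=> [x y /sE[u -> <-] /sE[v -> <-] [->] //|].
apply/setP => u; rewrite inE full_star_leaf//.
apply/imsetP/idP => [[x xM ->]|]; first by have [v ->] := sE x xM.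
by case: u => // u _; exists (val u); [apply: valP | rewrite /s valK].
Qed.

Section Pendant.
Variables (G : sgraph) (l : G).

Definition pendant_adj : rel (option G) :=
  [rel u v | match u, v with
             | Some x, Some y => adj x y
             | Some x, None | None, Some x => x == l
             | None, None => false
             end].

Lemma pendant_sym : symmetric pendant_adj.
Proof. by case=> [x|] [y|] //; rewrite /pendant_adj /= adj_sym. Qed.

Lemma pendant_irr : irreflexive pendant_adj.
Proof. by case=> [x|] //; rewrite /pendant_adj /= adj_irr. Qed.

Definition pendant : sgraph := SGraph pendant_sym pendant_irr.

Lemma pendant_tree : is_tree G -> is_tree pendant.
Proof.
move=> [_ conG acG]; split; first by apply/card_gt0P; exists None.
  have cl (u : pendant) : connect (@adj pendant) u (Some l).
    case: u => [x|]; last by apply: connect1; rewrite /= /pendant_adj /= eqxx.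
    have /connectP[p pth ->] := conG x l; apply/connectP.
    exists (map Some p); last by rewrite last_map.
    by rewrite path_map.
  move=> x y; apply: (connect_trans (cl x)).
  by rewrite sym_connect_sym //; apply: pendant_sym.
move=> c /andP[cyc unq].
case: (boolP (None \in c)) => [/rot_to[i p def_c]|nN].
  rewrite -(size_rot i) def_c; rewrite -(rot_cycle i) def_c in cyc.
  rewrite -(rot_uniq i) def_c in unq.
  case: p cyc unq {def_c} => [|[a|] [|b p]] //= /and3P[/eqP-> _].
  rewrite rcons_path => /andP[_] e /and3P[_ + _].
  case: (last b p) (mem_last b p) e => // x xin /eqP ex.
  by rewrite ex in xin; rewrite xin.
have [c' def_c] : exists c', c = map Some c'.
  elim: c nN {cyc unq} => [|[x|] c IHc]; first by exists [::].
    by rewrite inE => /IHc[c' ->]; exists (x :: c').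
  by rewrite inE eqxx.
rewrite def_c size_map; apply: acG; rewrite /ucycle.
rewrite def_c cycle_map map_inj_uniq in cyc unq; last exact: Some_inj.
by rewrite unq andbT.
Qed.

Lemma pendant_degree_None : degree (None : pendant) = 1.
Proof.
rewrite /degree (_ : [set y | _] = [set Some l]) ?cards1//.
by apply/setP => -[y|]; rewrite !inE.
Qed.

Lemma pendant_degree_Some (x : G) :
  degree (Some x : pendant) = (x == l) + degree x.
Proof.
rewrite /degree (cardsD1 None) inE /=; congr (_ + _).
have injS : injective (@Some G) by move=> y z [].
rewrite -(card_imset _ injS); congr #|pred_of_set _|.
apply/setP => -[y|]; rewrite !inE /=.
  by rewrite mem_imset ?inE.
by apply/esym/imsetP => -[].
Qed.

End Pendant.

Definition k2_adj : rel bool := [rel a b | a != b].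

Lemma k2_sym : symmetric k2_adj.
Proof. by case=> [] []. Qed.

Lemma k2_irr : irreflexive k2_adj.
Proof. by case. Qed.

Definition k2 : sgraph := SGraph k2_sym k2_irr.

Lemma k2_tree : is_tree k2.
Proof.
split; first by rewrite card_bool.
  by case=> [] []; rewrite ?connect0 ?connect1.
by move=> c /andP[_ /card_uniqP <-]; rewrite -card_bool max_card.
Qed.

Lemma k2_degree (x : k2) : degree x = 1.
Proof.
rewrite /degree (_ : [set y | _] = [set ~~ x]) ?cards1//.
by apply/setP => y; rewrite !inE; case: x y => [] [].
Qed.

Lemma subcubic_tree_exists (T : finType) (A : {set T}) : 1 < #|A| ->
  exists (G : sgraph) (s : T -> G),
    [/\ is_tree G, forall v : G, degree v = 1 \/ degree v = 3,
        {in A &, injective s} & s @: A = [set x | leaf x]].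
Proof.
have [n] := ubnP #|A|; elim: n A => // n IHn A; rewrite ltnS => leA A1.
have [a aA] : exists a, a \in A by apply/card_gt0P; apply: ltnW.
have cA : #|A| = (#|A :\ a|).+1 by rewrite (cardsD1 a) aA.
have [b bA] : exists b, b \in A :\ a by apply/card_gt0P; rewrite cA in A1.
have /andP[nba bA'] : (b != a) && (b \in A) by rewrite !inE in bA.
case: (ltnP 1 #|A :\ a|) => [gt1|le1]; last first.
  have defA : A = [set a; b].
    apply/eqP; rewrite eq_sym eqEcard subUset !sub1set aA bA' /=.
    by rewrite cA cards2 eq_sym nba.
  exists k2, (fun x => x == a : k2); split.
  - exact: k2_tree.
  - by move=> v; left; rewrite k2_degree.
  - move=> x y; rewrite defA !inE.
    by move=> /orP[] /eqP -> /orP[] /eqP -> //; rewrite eqxx (negPf nba).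
  - apply/setP => v; rewrite inE /leaf k2_degree eqxx; apply/imsetP.
    case: v; first by exists a; rewrite ?eqxx.
    by exists b => //; rewrite (negPf nba).
have [||G [s [tG dG injs ims]]] := IHn (A :\ a) => //; first by rewrite -cA.
pose l := s b; pose G1 := pendant l; pose l1 : G1 := Some l.
pose G2 := pendant l1.
have dl : degree l = 1.
  have : l \in [set x | leaf x] by rewrite -ims; apply: imset_f.
  by rewrite inE => /eqP.
have deg2 (x : G) : degree (Some (Some x) : G2) = (x == l) * 2 + degree x.
  rewrite !pendant_degree_Some addnA; congr (_ + _).
  by rewrite -[Some x == l1]/(x == l); case: eqP.
have degS : degree (Some None : G2) = 1.
  by rewrite pendant_degree_Some pendant_degree_None.
have degN : degree (None : G2) = 1 by rewrite pendant_degree_None.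
pose t (x : T) : G2 :=
  if x == a then None else if x == b then Some None else Some (Some (s x)).
exists G2, t; split.
- by do 2 apply: pendant_tree.
- case=> [[x|]|]; rewrite ?degS ?degN; [|by left|by left].
  rewrite deg2; case: eqP => [->|_]; first by right; rewrite dl.
  by rewrite mul0n; apply: dG.
- move=> x y xA yA; rewrite /t.
  case: (eqVneq x a) => xa; case: (eqVneq y a) => ya //; first by rewrite xa ya.
    by case: ifP.
    by case: ifP.
  case: (eqVneq x b) => xb; case: (eqVneq y b) => yb //; first by rewrite xb yb.
  by case=> /injs; apply; rewrite !inE ?xa ?ya.
apply/setP => v; rewrite inE /leaf.
case: v => [[x|]|]; rewrite ?degS ?degN ?eqxx.
- rewrite deg2; case: (eqVneq x l) => [->|xl].
    rewrite dl; apply/imsetP => -[z zA]; rewrite /t.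
    case: (eqVneq z a) => // za; case: (eqVneq z b) => // zb [] /esym e.
    move: zb; rewrite (injs z b) ?eqxx// !inE ?za ?nba//.
  rewrite mul0n; have := congr1 (fun S : {set G} => x \in S) ims.
  rewrite inE /leaf => <-; apply/imsetP/imsetP => -[z].
    rewrite /t; case: (eqVneq z a) => // za; case: (eqVneq z b) => // zb zA [->].
    by exists z => //; rewrite !inE za.
  rewrite !inE => /andP[za zA] ez; exists z => //; rewrite /t (negPf za).
  by case: (eqVneq z b) => [zb|_]; [move: xl; rewrite ez zb eqxx | rewrite ez].
- by apply/imsetP; exists b => //; rewrite /t (negPf nba) eqxx.
- by apply/imsetP; exists a => //; rewrite /t eqxx.
Qed.

Lemma branch_width_attained (T : finType) (M : matroid T) : 1 < #|ground M| ->
  exists (G : sgraph) (sigma : T -> G),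
    is_branch_decomposition M sigma /\
    branch_decomposition_width M sigma = branch_width M.
Proof.
move=> M1; rewrite /branch_width M1.
have [G [s [tG dG injs ims]]] := subcubic_tree_exists M1.
set P := (P in least P); case: (@leastP P) => //; exists (branch_decomposition_width M s), G, s.
by split=> //; split.
Qed.

(* Main.v *)
(** Fix a matroid M with branch-width at most w and a base B, and work in its
fundamental graph, never passing to a minor: deleting and contracting elements
freezes their membership in B, and every later change of base stays away from
frozen elements. A "candy" is a connected set C of large depth; a "stick" is an
induced path outside C of which only one end, its port, has neighbours in C. An
induced path on 2n vertices yields M(F_n), since the fundamental graph of M(F_n)
with respect to the spokes is a path and a matroid whose fundamental graph is a
path is determined by it.

Several sticks are grown around one candy. If there are fewer than 2w - 1 of
them, remove an element c from C and restrict to a component of C - c of large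
depth: either some port loses all its neighbours, and then its stick can be
prolonged along a path to the component, or c itself is the port of a new stick.
If there are 2w - 1 sticks, cut C by a separation X of the branch-decomposition
with both sides of large depth. At least w ports have the same status with
respect to B, which exceeds the connectivity of X, so some of these ports are
dependent over one side of C, and a change of base detaches one of them from the
other side; again its stick is prolonged. When a stick is prolonged, all sticks
that are not longer are dropped. Giving a stick of length l the weight (2w)^l,
the total weight increases at each step, so after at most (2w)^(2n-1) steps,
each costing a bounded amount of depth, some stick has 2n elements. *)
Require Import Defs.
From mathcomp Require Import all_boot.
From mathcomp Require Import boolp zify.

Set Implicit Arguments.
Unset Strict Implicit.
Unset Printing Implicit Defensive.

(** * Rank and duality *)


Section Rank.
Variables (T : finType) (M : matroid T).
Implicit Types (I J B X Y F V U : {set T}) (x y : T).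
Local Notation E := (ground M).
Local Notation r := (rank M).

Lemma rank_card X : r X <= #|X|.
Proof. by apply/rank_leP => I sI _; apply: subset_leq_card. Qed.

Lemma indepE I : indep M I = (r I == #|I|).
Proof.
apply/idP/eqP => [iI|rI].
  by apply/eqP; rewrite eqn_leq rank_card leq_rank.
have [B [_ sB iB cB]] := rank_basis (sub0set I) (indep0 M).
suff -> : I = B by [].
by apply/eqP; rewrite eq_sym eqEcard sB cB rI /=.
Qed.

Lemma rank_submod X Y : r (X :|: Y) + r (X :&: Y) <= r X + r Y.
Proof.
have [I [_ sI iI <-]] := rank_basis (sub0set (X :&: Y)) (indep0 M).
have sIU : I \subset X :|: Y.
  by apply: subset_trans sI _; apply: subset_trans (subsetIl _ _) (subsetUl _ _).
have [J [sIJ sJ iJ <-]] := rank_basis sIU iI.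
have lJ Z : #|J :&: Z| <= r Z.
  by apply: leq_rank (subsetIr _ _) _; apply: indepS iJ; apply: subsetIl.
apply: leq_trans (leq_add (lJ X) (lJ Y)).
rewrite -(cardsUI (J :&: X)) -setIUr (setIidPl sJ) leq_add2l.
by apply: subset_leq_card; rewrite -setIIr subsetI sIJ.
Qed.

Lemma rankU_le X Y : r (X :|: Y) <= r X + r Y.
Proof. by apply: leq_trans (rank_submod X Y); apply: leq_addr. Qed.

Lemma rankU_card X Y : r (X :|: Y) <= r X + #|Y|.
Proof. by apply: leq_trans (rankU_le X Y) _; rewrite leq_add2l rank_card. Qed.

(** Otherwise a basis of [F] could be augmented inside [F :|: V], and the added element would raise
    the rank of [F], which no element of [F] or [V] does. *)
Lemma rank_span F V : (forall x, x \in V -> r (x |: F) = r F) -> r (F :|: V) = r F.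
Proof.
move=> spanV; apply/eqP; rewrite eqn_leq (rankS M (subsetUl F V)) andbT.
have [B [_ sB iB cB]] := rank_basis (sub0set F) (indep0 M).
apply/rank_leP => I sI iI; rewrite leqNgt; apply/negP; rewrite -cB => /(indep_augment iB iI)[x].
rewrite inE => /andP[xB xI] ixB.
have : #|x |: B| <= r (x |: F) by apply: leq_rank ixB; apply: setUS.
rewrite cardsU1 xB cB.
suff -> : r (x |: F) = r F by rewrite ltnn.
have := subsetP sI x xI; rewrite inE => /orP[xF|/spanV //].
by rewrite (setUidPr _) ?sub1set.
Qed.

Definition base B : bool := indep M B && (#|B| == r E).

Lemma base_indep B : base B -> indep M B. Proof. by case/andP. Qed.
Lemma base_card B : base B -> #|B| = r E. Proof. by case/andP=> _ /eqP. Qed.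
Lemma base_sub B : base B -> B \subset E.
Proof. by move/base_indep/indep_ground. Qed.

Lemma base_ext I X : I \subset X -> indep M I -> r X = r E ->
  exists B, [/\ base B, I \subset B & B \subset X].
Proof.
move=> sI iI rX; have [B [? ? iB cB]] := rank_basis sI iI.
by exists B; split; rewrite // /base iB cB rX /=.
Qed.

Lemma base_exists : exists B, base B.
Proof. by have [B [bB _ _]] := base_ext (sub0set E) (indep0 M) erefl; exists B. Qed.

Lemma rank_base_sup B X : base B -> B \subset X -> r X = r E.
Proof.
move=> bB sB; apply/eqP; rewrite eqn_leq -{2}(base_card bB) leq_rank ?base_indep // andbT.
apply/rank_leP => I _ iI; exact: leq_rank (indep_ground iI) iI.
Qed.

Lemma base_eq B B' : base B -> base B' -> B \subset B' -> B = B'.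
Proof.
by move=> bB bB' s; apply/eqP; rewrite eqEcard s (base_card bB) (base_card bB') /=.
Qed.

Lemma baseE B X : base B -> #|X| = #|B| -> base X = indep M X.
Proof. by move=> bB cX; rewrite /base cX (base_card bB) eqxx andbT. Qed.

Lemma lambdaE X : lambda M X + r E = r X + r (E :\: X).
Proof. by rewrite /lambda subnK // leq_rank_ground. Qed.

Lemma lambda_compl X : X \subset E -> lambda M (E :\: X) = lambda M X.
Proof.
move=> sX; apply/eqP; rewrite -(eqn_add2r (r E)) !lambdaE addnC.
by rewrite setDDr setDv set0U (setIidPr sX).
Qed.

Lemma lambda_submod X Y :
  lambda M (X :|: Y) + lambda M (X :&: Y) <= lambda M X + lambda M Y.
Proof.
have := rank_submod X Y; have := rank_submod (E :\: X) (E :\: Y).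
rewrite -setDUr -setDIr.
have := lambdaE X; have := lambdaE Y.
by have := lambdaE (X :|: Y); have := lambdaE (X :&: Y); lia.
Qed.

Lemma lambdaI_le X Y : lambda M (X :&: Y) <= lambda M X + lambda M Y.
Proof. by apply: leq_trans (lambda_submod X Y); apply: leq_addl. Qed.

Lemma lambdaU_le X Y : lambda M (X :|: Y) <= lambda M X + lambda M Y.
Proof. by apply: leq_trans (lambda_submod X Y); apply: leq_addr. Qed.

Lemma lambda_ground : lambda M E = 0.
Proof.
apply/eqP; rewrite -(eqn_add2r (r E)) lambdaE setDv add0n.
suff -> : r set0 = 0 by rewrite addn0.
by apply/eqP; rewrite -leqn0 -(@cards0 T) rank_card.
Qed.

Lemma lambda_card X : lambda M X <= #|X|.
Proof.
have := lambdaE X; have := rank_card X; have : r (E :\: X) <= r E by apply/rankS/subsetDl.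
by lia.
Qed.

(** Removing [Y] amounts to intersecting with the complement of [Y :&: E], and connectivity is
    invariant under complementation. *)
Lemma lambdaD_le X Y : X \subset E -> lambda M (X :\: Y) <= lambda M X + lambda M Y.
Proof.
move=> sX; have -> : X :\: Y = X :&: (E :\: (Y :&: E)).
  by apply/setP=> z; rewrite !inE; case zX: (z \in X); rewrite ?andbF // (subsetP sX) // !andbT.
apply: leq_trans (lambdaI_le _ _) _; rewrite leq_add2l lambda_compl ?subsetIr //.
by apply: leq_trans (lambdaI_le _ _) _; rewrite lambda_ground addn0.
Qed.

Section Dual.

Definition coindep : pred {set T} := [pred I : {set T} | (I \subset E) && (r (E :\: I) == r E)].

Lemma coindep_ground I : coindep I -> I \subset E. Proof. by case/andP. Qed.
Lemma coindep0 : coindep set0.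
Proof. by rewrite /coindep /= sub0set setD0 /=. Qed.
Lemma coindepS I J : J \subset I -> coindep I -> coindep J.
Proof.
move=> sJI /andP[sI /eqP rI]; rewrite /coindep /= (subset_trans sJI sI) /=.
by rewrite eqn_leq rankS ?subsetDl // -rI rankS // setDS.
Qed.

(** Let [B3] be a base avoiding [I] and containing a basis [B1] of the complement of [I :|: J]. Any
    element of [J :\: I] outside [B3] can be added to [I]. If there were none, [B3] would contain
    [B1 :|: (J :\: I)], which is larger than a base [B2] containing [B1] and avoiding [J]. *)
Lemma coindep_augment I J : coindep I -> coindep J -> #|I| < #|J| ->
  exists2 x, x \in J :\: I & coindep (x |: I).
Proof.
move=> /andP[sI /eqP rI] /andP[sJ /eqP rJ] ltIJ.
have [B1 [_ sB1 iB1 cB1]] := rank_basis (sub0set (E :\: (I :|: J))) (indep0 M).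
have sB1I : B1 \subset E :\: I by apply: subset_trans sB1 _; apply/setDS/subsetUl.
have sB1J : B1 \subset E :\: J by apply: subset_trans sB1 _; apply/setDS/subsetUr.
have [B2 [bB2 sB12 sB2]] := base_ext sB1J iB1 rJ.
have [B3 [bB3 sB13 sB3]] := base_ext sB1I iB1 rI.
have maxB1 B' : indep M B' -> #|B' :&: (E :\: (I :|: J))| <= #|B1|.
  by move=> iB'; rewrite cB1 leq_rank ?subsetIr //; apply: indepS iB'; apply: subsetIl.
have cB2 : #|B2| <= #|B1| + #|I :\: J|.
  rewrite -(cardsID (E :\: (I :|: J)) B2) leq_add ?maxB1 ?base_indep // subset_leq_card //.
  apply/subsetP => z; rewrite !inE => /andP[nz zB2]; move: nz.
  by have := subsetP sB2 z zB2; rewrite !inE; do 3 case: (z \in _).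
have [/existsP[x /andP[xJI xB3]]|] := boolP [exists x, (x \in J :\: I) && (x \notin B3)].
  exists x => //; move: xJI; rewrite inE => /andP[xI xJ].
  rewrite /coindep /= subUset sub1set (subsetP sJ) // sI /=.
  apply/eqP/(rank_base_sup bB3); apply/subsetP => z zB3.
  have := subsetP sB3 z zB3; rewrite !inE => /andP[zI ->]; rewrite andbT negb_or zI andbT.
  by apply: contraNneq xB3 => <-.
rewrite negb_exists => /forallP none.
have sub : B1 :|: (J :\: I) \subset B3.
  rewrite subUset sB13 /=; apply/subsetP => z zJI.
  by have := none z; rewrite zJI /= negbK.
have := subset_leq_card sub; rewrite (base_card bB3) -(base_card bB2).
rewrite cardsU (_ : B1 :&: (J :\: I) = set0) ?cards0 ?subn0; last first.
  apply/setP => z; rewrite !inE; apply/negP => /and3P[zB1 _ zJ].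
  by have := subsetP sB1J z zB1; rewrite inE zJ.
move/leq_trans/(_ cB2); rewrite leq_add2l => le.
have := cardsID J I; have := cardsID I J; rewrite (setIC J I).
by move: ltIJ le; clear; lia.
Qed.

Definition dual : matroid T := Matroid coindep_ground coindep0 coindepS coindep_augment.

End Dual.

(** Both bounds count against a base: one chosen to avoid a largest coindependent subset of [X], the
    other to contain a basis of [E :\: X]. *)
Lemma rank_dual X : X \subset E -> rank dual X + r E = #|X| + r (E :\: X).
Proof.
move=> sX; apply/eqP; rewrite eqn_leq; apply/andP; split.
  have [I [_ sI iI <-]] := rank_basis (sub0set X) (indep0 dual).
  case/andP: (iI) => _ /eqP rI.
  have [B [bB _ sB]] := base_ext (sub0set _) (indep0 M) rI.
  rewrite -(base_card bB) -(cardsID X B).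
  have -> : #|X| = #|I| + #|X :\: I| by rewrite cardsD (setIidPr sI) subnKC // subset_leq_card.
  rewrite -addnA leq_add2l leq_add //.
    apply/subset_leq_card/subsetP => z; rewrite !inE => /andP[zB ->]; rewrite andbT.
    by have := subsetP sB z zB; rewrite inE => /andP[].
  apply: leq_rank; first by apply: setSD; apply: base_sub.
  by apply: indepS (base_indep bB); apply: subsetDl.
have [B1 [_ sB1 iB1 cB1]] := rank_basis (sub0set (E :\: X)) (indep0 M).
have [B [bB sB1B sB]] := base_ext (subset_trans sB1 (subsetDl _ _)) iB1 erefl.
have cBX : #|B1| <= #|B :\: X|.
  apply/subset_leq_card/subsetP => z zB1; rewrite inE (subsetP sB1B) // andbT.
  by have := subsetP sB1 z zB1; rewrite inE => /andP[].
have : #|X :\: B| <= rank dual X.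
  apply: leq_rank; first exact: subsetDl.
  rewrite /= /coindep /= (subset_trans (subsetDl _ _) sX) /=.
  apply/eqP/(rank_base_sup bB); apply/subsetP => z zB; rewrite !inE zB.
  by rewrite (subsetP sB).
rewrite -cB1 -(base_card bB).
have := cardsID X B; have := cardsID B X; rewrite (setIC B X).
by move: cBX; clear; lia.
Qed.

Lemma lambda_dual X : X \subset E -> lambda dual X = lambda M X.
Proof.
move=> sX; have d1 := rank_dual sX; have d2 := rank_dual (subsetDl E X).
have d3 := rank_dual (subxx E); have l := lambdaE X.
have : lambda dual X + rank dual E = rank dual X + rank dual (E :\: X).
  by rewrite /lambda subnK // (leq_rank_ground dual X).
have r0 : r set0 = 0 by apply/eqP; rewrite -leqn0 -(@cards0 T) rank_card.
rewrite setDv r0 in d3; rewrite setDDr setDv set0U (setIidPr sX) in d2.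
have := cardsID X E; rewrite (setIidPr sX).
by lia.
Qed.

Lemma dual_base X : X \subset E -> (@indep T dual X && (#|X| == rank dual E)) = base (E :\: X).
Proof.
move=> sX; rewrite [indep dual X]/= /coindep /= sX /=.
have := rank_dual (subxx E); rewrite setDv.
have -> : r set0 = 0 by apply/eqP; rewrite -leqn0 -(@cards0 T) rank_card.
have := cardsID X E; rewrite (setIidPr sX) addn0 => cE rE.
rewrite /base indepE; apply/andP/andP => -[/eqP h1 /eqP h2]; split; apply/eqP; lia.
Qed.

End Rank.

(** * Fundamental graphs *)


Section FundamentalGraph.
Variables (T : finType) (M : matroid T).
Implicit Types (I J B C D X Y F V U : {set T}) (x y : T).
Local Notation E := (ground M).
Local Notation r := (rank M).

(** The edges of the fundamental graph, directed from an element outside the base to the base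
    elements on its fundamental circuit; [fadj] forgets the direction. *)
Definition exchange B : rel T :=
  [rel x y | [&& x \in E, x \notin B, y \in B & base M (x |: B :\ y)]].

Definition fadj B : rel T := [rel x y | exchange B x y || exchange B y x].

Lemma fadj_sym B : symmetric (fadj B).
Proof. by move=> x y; rewrite /fadj /= orbC. Qed.

Lemma fadj_ground B x y : base M B -> fadj B x y -> x \in E.
Proof.
move=> bB /orP[/and3P[//]|/and4P[_ _ xB _]].
by apply: (subsetP (base_sub bB)).
Qed.

Lemma fadj_alt B x y : fadj B x y -> (x \in B) = (y \notin B).
Proof. by case/orP => /and4P[_ /negPf-> -> _]. Qed.

Lemma fadjC B x y : x \notin B -> fadj B x y = exchange B x y.
Proof.
by move=> nx; rewrite /fadj /= [exchange B y x]/exchange /= (negPf nx) !andbF orbF.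
Qed.

Lemma swap_card B x y : x \notin B -> y \in B -> #|x |: B :\ y| = #|B|.
Proof.
move=> nx yB; rewrite cardsU1 !inE (negPf nx) andbF /=.
by rewrite (cardsD1 y B) yB.
Qed.

Lemma swap_base B B' x : base M B -> base M B' -> x \notin B -> x \in B' ->
  B' \subset x |: B -> exists2 y, y \in B :\: B' & B' = x |: B :\ y.
Proof.
move=> bB bB' nx xB' sB'.
have [y yB ny] : exists2 y, y \in B & y \notin B'.
  apply/subsetPn; apply/negP => sBB'; move: nx.
  by rewrite (base_eq bB bB' sBB') xB'.
exists y; first by rewrite inE ny.
apply/eqP; rewrite eqEcard swap_card // (base_card bB) (base_card bB') leqnn andbT.
apply/subsetP => z zB'; rewrite !inE; have := subsetP sB' z zB'; rewrite !inE.
case: eqP => //= _ ->; rewrite andbT; by apply: contraNneq ny => <-.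
Qed.

(** The neighbours of [x] are the other elements of its fundamental circuit. An independent [x |: F]
    extends to a base inside [x |: B], and the element of [B] missing from that base is a neighbour
    outside [F]. *)
Lemma fadj_span B F x : base M B -> F \subset B -> x \in E -> x \notin B ->
  indep M (x |: F) = [exists y in B :\: F, fadj B x y].
Proof.
move=> bB sF xE nx; apply/idP/existsP => [iF|[y /andP[/setDP[yB yF]]]]; last first.
  rewrite fadjC // => /and4P[_ _ _ /base_indep]; apply: indepS.
  apply: setUS; rewrite subsetD1 sF; exact: yF.
have sxB : x |: F \subset x |: B by apply: setUS.
have rB : r (x |: B) = r E by apply: (rank_base_sup bB); apply: subsetUr.
have [B' [bB' sFB' sB']] := base_ext sxB iF rB.
have xB' : x \in B' by apply: (subsetP sFB'); rewrite !inE eqxx.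
have [y /setDP[yB nyB'] eB'] := swap_base bB bB' nx xB' sB'.
exists y; rewrite !inE yB fadjC // /exchange /= xE nx yB -eB' bB' !andbT.
by apply: contra nyB' => yF; apply: (subsetP sFB'); rewrite !inE yF orbT.
Qed.

Lemma fadj_indep B x y : base M B -> x \in E -> x \notin B -> y \in B ->
  fadj B x y = indep M (x |: B :\ y).
Proof.
by move=> bB xE nx yB; rewrite fadjC // /exchange /= xE nx yB /= (baseE bB) // swap_card.
Qed.

Lemma base_dual X : X \subset E -> base (dual M) X = base M (E :\: X).
Proof. exact: dual_base. Qed.

End FundamentalGraph.

Section FundamentalDual.
Variables (T : finType) (M : matroid T).
Implicit Types (I J B C D X Y F V U : {set T}) (x y : T).
Local Notation E := (ground M).
Local Notation r := (rank M).

Lemma base_dualC B : base M B -> base (dual M) (E :\: B).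
Proof.
by move=> bB; rewrite base_dual ?subsetDl // setDDr setDv set0U (setIidPr (base_sub bB)).
Qed.

(** Complementing the base exchanges the two sides of the bipartite graph, so facts about elements
    outside the base dualize to facts about elements inside it. *)
Lemma exchange_dual B x y : base M B ->
  exchange (dual M) (E :\: B) x y = exchange M B y x.
Proof.
move=> bB; have sB := subsetP (base_sub bB); rewrite /exchange /= !inE.
case: (boolP (y \in E)) => yE; rewrite ?andbF //=.
case: (boolP (y \in B)) => yB; rewrite ?andbF //=.
case: (boolP (x \in B)) => xB /=; last by case: (x \in E).
rewrite (sB x xB) /= base_dual; last first.
  by rewrite subUset sub1set sB //= (subset_trans (subsetDl _ _)) ?subsetDl.
congr (base M _); apply/setP => z; rewrite !inE.
have nyx : (y == x) = false by apply: contraNF yB => /eqP->.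
case: (eqVneq z y) => [->|zy]; first by rewrite nyx (negPf yB) yE.
case: (eqVneq z x) => [->|zx] /=; first by rewrite ?eqxx ?andbF ?(negPf zy) ?xB ?nyx.
by case: (boolP (z \in B)) => [/sB->|_] //=; rewrite andNb.
Qed.

Lemma fadj_dual B x y : base M B -> fadj (dual M) (E :\: B) x y = fadj M B x y.
Proof. by move=> bB; rewrite /fadj /= !exchange_dual // orbC. Qed.

End FundamentalDual.

(** * Fundamental graphs under a change of base *)

Section Change.

(** The fundamental circuit of [x] with respect to [B] avoids [D], hence lies in [x |: (B :\: D)].
    This set is also contained in [x |: B'], so the circuit is the same for [B']. *)
Lemma fadj_change_out (T : finType) (M : matroid T) (B B' D : {set T}) (x y : T) :
  base M B -> base M B' -> B :\: D = B' :\: D -> x \notin D -> x \notin B ->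
  (forall z, z \in D -> ~~ fadj M B x z) ->
  fadj M B' x y = (y \notin D) && fadj M B x y.
Proof.
move=> bB bB' eBD xD xB nD.
have memB z : z \notin D -> (z \in B) = (z \in B').
  by move=> zD; have := congr1 (fun S : {set T} => z \in S) eBD; rewrite !inE zD.
have xB' : x \notin B' by rewrite -memB.
case xE: (x \in ground M); last first.
  have no (B1 : {set T}) : base M B1 -> fadj M B1 x y = false.
    by move=> b1; apply/negP => /(fadj_ground b1); rewrite xE.
  by rewrite !no // andbF.
set F := B :\: D.
have sF : F \subset B by apply: subsetDl.
have sF' : F \subset B' by rewrite /F eBD subsetDl.
have nF : ~~ indep M (x |: F).
  rewrite (fadj_span bB sF) //; apply/existsP => -[z /andP[/setDP[zB]]].
  by rewrite inE zB andbT negbK => zD; apply/negP/nD.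
case yD: (y \in D) => /=.
  case yB': (y \in B'); last first.
    by apply/negP => /fadj_alt; rewrite yB' (negPf xB').
  apply/negP => a; move: nF; rewrite (fadj_span bB' sF') //.
  by move/negP; apply; apply/existsP; exists y; rewrite a !inE yB' yD.
case yB: (y \in B); last first.
  have h (B1 : {set T}) : x \notin B1 -> y \notin B1 -> fadj M B1 x y = false.
    by move=> nx ny; apply/negP => /fadj_alt; rewrite (negPf nx) ny.
  by rewrite !h // -?memB ?yB ?yD.
have yF : y \in F by rewrite inE yB yD.
(* Adjacency to an element of the common part [F] is expressed without mentioning the base: the
   circuit of [x] lies in [x |: F], and [y] is on it iff its removal leaves an independent set. *)
have key (B1 : {set T}) : base M B1 -> F \subset B1 -> x \notin B1 ->
    fadj M B1 x y = indep M (x |: F :\ y).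
  move=> b1 s1 nx1; rewrite (fadj_indep b1 xE nx1 (subsetP s1 y yF)).
  apply/idP/idP => [|iF]; first by apply: indepS; apply/setUS/setSD.
  have rB : rank M (x |: B1) = rank M (ground M).
    by apply: (rank_base_sup b1); apply: subsetUr.
  have [|B2 [b2 sF2 sB2]] := base_ext _ iF rB.
    by apply: setUS; apply: subset_trans s1; apply: subsetDl.
  have xB2 : x \in B2 by apply: (subsetP sF2); rewrite !inE eqxx.
  have [z /setDP[zB1 nz] eB2] := swap_base b1 b2 nx1 xB2 sB2.
  suff <- : z = y by rewrite -eB2 base_indep.
  apply/eqP; apply: contraNT nF => zy.
  apply: indepS (base_indep b2); apply/subsetP => u; rewrite in_setU1 => /orP[/eqP->//|uF].
  rewrite eB2 in_setU1 in_setD1 (subsetP s1) // andbT.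
  apply/orP; right; apply: contraNneq nz => uz; apply: (subsetP sF2).
  by rewrite -uz in_setU1 in_setD1 uF uz zy orbT.
by rewrite !key.
Qed.

(* An element with no neighbour in D keeps its fundamental circuit or cocircuit
   under any change of base inside D. *)
Lemma fadj_change (T : finType) (M : matroid T) (B B' D : {set T}) (x y : T) :
  base M B -> base M B' -> B :\: D = B' :\: D -> x \notin D ->
  (forall z, z \in D -> ~~ fadj M B x z) ->
  fadj M B' x y = (y \notin D) && fadj M B x y.
Proof.
move=> bB bB' eBD xD nD.
case: (boolP (x \in B)) => xB; last exact: fadj_change_out.
rewrite -(fadj_dual x y bB) -(fadj_dual x y bB').
apply: fadj_change_out => //; try exact: base_dualC.
- apply/setP => z; have := congr1 (fun S : {set T} => z \in S) eBD.
  by rewrite !inE; case: (z \in D) => //= ->.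
- by rewrite inE xB.
by move=> z zD; rewrite fadj_dual // nD.
Qed.

End Change.

(** * Separations and components of the fundamental graph *)

Section Components.
Variables (T : finType) (M : matroid T).
Implicit Types (I J B C D X Y F V U : {set T}) (x y : T).
Local Notation E := (ground M).
Local Notation r := (rank M).

Definition separated B V V' : Prop :=
  forall x y, x \in V -> y \in V' -> ~~ fadj M B x y.

(** An element of [V] outside [B] has all its neighbours in [F = (B :\: U) :|: (B :&: V)], or
    outside [U], hence in [F] again; so the independent set [F] spans [V]. *)
Lemma separated_rank B U V : base M B -> U \subset E -> V \subset U ->
  separated B V (U :\: V) -> r (B :\: U :|: V) = #|B :\: U| + #|B :&: V|.
Proof.
move=> bB sU sV sep; set A := B :\: U.
pose F := A :|: (B :&: V).
have sF : F \subset B by rewrite subUset subsetDl subsetIl.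
have dF : A :&: (B :&: V) = set0.
  by apply/setP => z; rewrite !inE; case zV: (z \in V); rewrite ?andbF // (subsetP sV).
have rF : r F = #|F| by apply/eqP; rewrite -indepE; apply: indepS sF (base_indep bB).
have cF : #|F| = #|A| + #|B :&: V| by rewrite cardsU dF cards0 subn0.
have -> : A :|: V = F :|: V.
  by rewrite /F -setUA (setUidPr (subsetIr B V)).
rewrite rank_span ?rF // => x xV.
apply/eqP; rewrite eqn_leq -{2}rF (rankS M (subsetUr [set x] F)) andbT.
case xB: (x \in B).
  rewrite (setUidPr _) ?sub1set ?rF // !inE xB xV /=; exact: orbT.
have xF : x \notin F by apply: contraFN xB; apply: (subsetP sF).
have niF : ~~ indep M (x |: F).
  rewrite (fadj_span bB sF) ?xB //; last by apply/(subsetP sU)/(subsetP sV).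
  apply/existsP => -[y /andP[/setDP[yB]]]; rewrite !inE yB /= andbT negb_or negbK => /andP[yU yV].
  by apply/negP/sep => //; rewrite inE yV.
have := rank_card M (x |: F); rewrite leq_eqVlt; rewrite indepE in niF.
by rewrite (negPf niF) /= cardsU1 xF.
Qed.

(** A converse for edges that leave [V] from outside the base: such an edge at [x] would make
    [x |: F] independent, against the rank. The other edges are reached by exchanging [V] and
    [U :\: V]. *)
Lemma rank_separated B U V : base M B -> V \subset U ->
  r (B :\: U :|: V) = #|B :\: U| + #|B :&: V| ->
  forall x y, x \in V -> x \notin B -> y \in U :\: V -> ~~ fadj M B x y.
Proof.
move=> bB sV rV x y xV xB /setDP[yU yV]; apply/negP => a.
pose F := (B :\: U) :|: (B :&: V).
have sF : F \subset B by rewrite subUset subsetDl subsetIl.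
have yB : y \in B by move/fadj_alt: a; rewrite (negPf xB); case: (y \in B).
have iF : indep M (x |: F).
  rewrite (fadj_span bB sF) // ?(fadj_ground bB a) //; apply/existsP; exists y.
  by rewrite a !inE yB yU (negPf yV).
have : #|x |: F| <= r (B :\: U :|: V).
  apply: leq_rank iF; rewrite subUset sub1set !inE xV orbT /=.
  by rewrite setUS // subsetIr.
rewrite rV cardsU1 (contra (subsetP sF x)) // cardsU.
suff -> : (B :\: U) :&: (B :&: V) = set0 by rewrite cards0 subn0 ltnn.
by apply/setP => z; rewrite !inE; case zV: (z \in V); rewrite ?andbF // (subsetP sV).
Qed.

Lemma separated_sym B V V' : separated B V V' -> separated B V' V.
Proof. by move=> h x y xV yV'; rewrite fadj_sym h. Qed.

Lemma cardsI_part B U V : V \subset U ->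
  #|B :\: U| + #|B :&: V| + #|B :&: (U :\: V)| = #|B|.
Proof.
move=> sV; have := cardsID U B; have := cardsID V (B :&: U).
by rewrite -setIA (setIidPr sV) setIDA; lia.
Qed.

(** The ranks of [V] and [U :\: V] over [B :\: U] do not depend on the base inside [U]. They add up
    to [r E - #|B :\: U|], because [B] attains both; since [B'] has the size of [B], it attains both
    as well, and [rank_separated] applies to it. *)
Lemma separated_change B B' U V : base M B -> base M B' -> U \subset E -> V \subset U ->
  B :\: U = B' :\: U -> separated B V (U :\: V) -> separated B' V (U :\: V).
Proof.
move=> bB bB' sU sV eU sep.
have DV : U :\: (U :\: V) = V by rewrite setDDr setDv set0U (setIidPr sV).
have r1 := separated_rank bB sU sV sep.
have r2 : r (B :\: U :|: (U :\: V)) = #|B :\: U| + #|B :&: (U :\: V)|.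
  apply: separated_rank => //; first exact: subsetDl.
  by rewrite DV; apply: separated_sym.
have lo (W : {set T}) : W \subset U -> #|B' :\: U| + #|B' :&: W| <= r (B' :\: U :|: W).
  move=> sW; have : #|(B' :\: U) :|: (B' :&: W)| <= r (B' :\: U :|: W).
    apply: leq_rank; first by rewrite setUS // subsetIr.
    by apply: indepS (base_indep bB'); rewrite subUset subsetDl subsetIl.
  rewrite cardsU (_ : (B' :\: U) :&: (B' :&: W) = set0) ?cards0 ?subn0 //.
  by apply/setP => z; rewrite !inE; case zV: (z \in W); rewrite ?andbF // (subsetP sW).
have l1 := lo _ sV; have l2 := lo _ (subsetDl U V).
have c1 := cardsI_part B sV; have c2 := cardsI_part B' sV.
rewrite (base_card bB) in c1; rewrite (base_card bB') -eU in c2.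
rewrite -eU in l1 l2.
have e1 : r (B' :\: U :|: V) = #|B' :\: U| + #|B' :&: V| by rewrite -eU; lia.
have e2 : r (B' :\: U :|: (U :\: V)) = #|B' :\: U| + #|B' :&: (U :\: V)| by rewrite -eU; lia.
move=> x y xV yV; case xB: (x \in B'); last first.
  by apply: (rank_separated bB' sV e1) => //; rewrite xB.
case yB: (y \in B'); first by apply/negP => /fadj_alt; rewrite xB yB.
rewrite fadj_sym; apply: (rank_separated bB' (subsetDl _ _) e2) => //; rewrite ?yB //.
by rewrite DV.
Qed.

(** Moving [V' = U :\: V] across the cut raises the rank of the outside by at most [#|B :&: V'|] and
    lowers the rank of the inside by at least as much. *)
Lemma lambda_separated B U V : base M B -> U \subset E -> V \subset U ->
  separated B V (U :\: V) -> lambda M V <= lambda M U.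
Proof.
move=> bB sU sV sep.
have DV : U :\: (U :\: V) = V by rewrite setDDr setDv set0U (setIidPr sV).
set V' := U :\: V in sep *; set A := B :\: U; set O := E :\: U.
have r1 : r (A :|: V) = #|A| + #|B :&: V| := separated_rank bB sU sV sep.
have r2 : r (A :|: V') = #|A| + #|B :&: V'|.
  by apply: separated_rank; rewrite ?subsetDl // DV; apply: separated_sym.
have sAO : A \subset O by apply/setSD/base_sub.
have EV : E :\: V = O :|: V'.
  apply/setP => z; rewrite !inE; case: (boolP (z \in V)) => [/(subsetP sV)->|_] //=.
  by case: (boolP (z \in U)) => [/(subsetP sU)->|] //=; rewrite orbF.
have rA : r A = #|A| by apply/eqP; rewrite -indepE; apply: indepS (base_indep bB); apply: subsetDl.
have up : r (O :|: V') <= r O + #|B :&: V'|.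
  have := rank_submod M O (A :|: V').
  rewrite setUA (setUidPl sAO) r2.
  have : r A <= r (O :&: (A :|: V')) by apply: rankS; rewrite subsetI sAO subsetUl.
  by rewrite rA; lia.
have lo : r V + #|B :&: V'| <= r U.
  have := rank_submod M (A :|: V) (V :|: (B :&: V')).
  have -> : A :|: V :|: (V :|: (B :&: V')) = A :|: V :|: (B :&: V').
    by rewrite setUA -(setUA A) setUid.
  have : r V <= r ((A :|: V) :&: (V :|: (B :&: V'))).
    by apply: rankS; rewrite subsetI subsetUr subsetUl.
  have : r (V :|: (B :&: V')) <= r U.
    by apply: rankS; rewrite subUset sV (subset_trans (subsetIr _ _)) ?subsetDl.
  have : r E <= r (A :|: V :|: (B :&: V')).
    rewrite -(rank_base_sup bB (X := A :|: V :|: (B :&: V'))) //.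
    apply/subsetP => z zB; rewrite !inE zB /=.
    by case: (z \in V); rewrite ?orbT //=; case: (z \in U).
  have := cardsI_part B sV; rewrite (base_card bB) -/V' -/A => <-.
  by rewrite r1; lia.
have := lambdaE M V; have := lambdaE M U; rewrite EV -/O; lia.
Qed.

Definition within B U : rel T := [rel x y | [&& x \in U, y \in U & fadj M B x y]].

Lemma within_sym B U : connect_sym (within B U).
Proof.
by apply: sym_connect_sym => x y; rewrite /within /= fadj_sym andbCA.
Qed.

Lemma withinS B U U' : U \subset U' -> subrel (within B U) (within B U').
Proof. by move=> s x y /and3P[xU yU a]; apply/and3P; split=> //; apply: (subsetP s). Qed.

Lemma connect_withinS B U U' x y : U \subset U' ->
  connect (within B U) x y -> connect (within B U') x y.
Proof. by move=> s; apply: connect_sub => u v /(withinS s)/connect1. Qed.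

Definition gconnected B U : Prop :=
  forall x y, x \in U -> y \in U -> connect (within B U) x y.

Lemma gconnected_separated B U V x : gconnected B U -> x \in V -> V \subset U ->
  separated B V (U :\: V) -> V = U.
Proof.
move=> con xV sV sep; apply/eqP; rewrite eqEsubset sV; apply/subsetP => y yU.
have := con x y (subsetP sV x xV) yU => /connectP[p pth ->] {y yU}.
elim: p x xV pth => //= z p IHp x xV /andP[/and3P[_ zU a] pth].
apply: IHp pth; apply: contraLR a => zV; apply: sep => //; by rewrite inE zV.
Qed.

Lemma gconnectedP B U : (forall V x, x \in V -> V \subset U -> separated B V (U :\: V) -> V = U) ->
  gconnected B U.
Proof.
move=> h x y xU yU; pose V := [set z in U | connect (within B U) x z].
have VU : V = U.
  apply: (h V x); first by rewrite inE xU connect0.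
    by apply/subsetP => z; rewrite inE => /andP[].
  move=> u v; rewrite inE => /andP[uU cu] /setDP[vU nv]; apply: contra nv => a.
  by rewrite inE vU (connect_trans cu) // connect1 //; apply/and3P.
have : y \in V by rewrite VU.
by rewrite inE => /andP[].
Qed.

(** Connectivity means that there is no proper separation, and a separation for [B'] is one for
    [B]. *)
Lemma gconnected_change B B' U : base M B -> base M B' -> U \subset E ->
  B :\: U = B' :\: U -> gconnected B U -> gconnected B' U.
Proof.
move=> bB bB' sU eU con; apply: gconnectedP => V x xV sV sep.
by apply: (gconnected_separated con xV sV); apply: separated_change sep.
Qed.

Definition component B U x : {set T} := [set y in U | connect (within B U) x y].

Lemma component_sub B U x : component B U x \subset U.
Proof. by apply/subsetP => z; rewrite inE => /andP[]. Qed.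

Lemma component_separated B U x : separated B (component B U x) (U :\: component B U x).
Proof.
move=> u v; rewrite inE => /andP[uU cu] /setDP[vU nv]; apply: contra nv => a.
by rewrite inE vU (connect_trans cu) // connect1 //; apply/and3P.
Qed.

Lemma component_connected B U x : gconnected B (component B U x).
Proof.
have cl u y : u \in component B U x -> connect (within B U) u y ->
    connect (within B (component B U x)) u y.
  move=> uC /connectP[p pth ->] {y}; elim: p u uC pth => //= z p IHp u uC /andP[e pth].
  have zC : z \in component B U x.
    move: uC; rewrite !inE => /andP[uU cu]; case/and3P: (e) => _ -> _ /=.
    by rewrite (connect_trans cu) // connect1.
  apply: connect_trans (IHp z zC pth); apply: connect1; apply/and3P.
  by split=> //; case/and3P: e.
move=> u v uC vC; apply: cl => //; move: uC vC; rewrite !inE => /andP[_ cu] /andP[_ cv].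
by rewrite (connect_trans _ cv) // within_sym.
Qed.

End Components.

(** * Dependent ports and depth *)


Section Ports.

(** Extend [B :\: C] to a basis [J] of [B :\: C :|: Z] and let [S] be a minimal subset of [Q] that
    is dependent together with [J]. For a base [B'] containing [J :|: S :\ p], the fundamental
    circuit of [p] lies in [J :|: S], which misses [C :\: Z]. *)
Lemma dependent_side (T : finType) (M : matroid T) (B C Z Q : {set T}) :
  base M B -> [disjoint Q & B] -> [disjoint Q & C] -> Q \subset ground M -> Z \subset C ->
  rank M (B :\: C :|: Z :|: Q) < rank M (B :\: C :|: Z) + #|Q| ->
  exists S : {set T}, [/\ S \subset Q, S != set0 & forall p, p \in S ->
    exists B', [/\ base M B', B' :\: (C :|: S :\ p) = B :\: (C :|: S :\ p) &
      forall y, y \in C :\: Z -> ~~ fadj M B' p y]].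
Proof.
move=> bB dQB dQC sQE sZC lt; set A := B :\: C in lt *.
have iA : indep M A by apply: indepS (base_indep bB); apply: subsetDl.
have [J [sAJ sJ iJ cJ]] := rank_basis (subsetUl A Z) iA.
have nQ x : x \in Q -> (x \notin B) * (x \notin C).
  by move=> xQ; rewrite (disjointFr dQB xQ) (disjointFr dQC xQ).
have dJQ : [disjoint J & Q].
  apply/pred0P => x /=; apply/negP => /andP[/(subsetP sJ) + xQ].
  rewrite !inE (negPf (nQ x xQ).1) (negPf (nQ x xQ).2) /= => /(subsetP sZC).
  by rewrite (negPf (nQ x xQ).2).
have nJQ : ~~ indep M (J :|: Q).
  apply/negP => iJQ; have : #|J :|: Q| <= rank M (A :|: Z :|: Q).
    by apply: leq_rank iJQ; apply: setSU.
  rewrite cardsU (_ : J :&: Q = set0); last by apply/eqP; rewrite setI_eq0.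
  by rewrite cards0 subn0 cJ leqNgt lt.
have [S minS sSQ] := @minset_exists T (fun S => ~~ indep M (J :|: S)) Q nJQ.
have [nS minimal] := minsetP minS.
exists S; split=> //; first by apply: contraNneq nS => ->; rewrite setU0.
move=> p pS; set S' := S :\ p.
have pQ : p \in Q := subsetP sSQ p pS.
have iS' : indep M (J :|: S').
  apply/negPn/negP => n; have := minimal S' n (subsetDl _ _) => e.
  by move: pS; rewrite -e !inE eqxx.
have sS'Q : S' \subset Q by apply: subset_trans (subsetDl _ _) sSQ.
have sX : J :|: S' \subset C :|: S' :|: A.
  rewrite subUset (subset_trans sJ) /=; last first.
    by rewrite subUset subsetUr (subset_trans sZC) // -setUA subsetUl.
  by rewrite (subset_trans (subsetUr C S')) ?subsetUl.
have rX : rank M (C :|: S' :|: A) = rank M (ground M).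
  apply: (rank_base_sup bB); apply/subsetP => x xB; rewrite !inE xB.
  by case: (x \in C); rewrite ?orbT.
have [B' [bB' sJB' sB']] := base_ext sX iS' rX.
have sJ' : J \subset B' by apply: subset_trans sJB'; apply: subsetUl.
exists B'; split=> //.
  apply/setP => x; rewrite !in_setD !in_setU; case xC: (x \in C) => //=.
  case xS': (x \in S') => //=; apply/idP/idP => xB.
    by have := subsetP sB' x xB; rewrite !in_setU xC xS' /= inE => /andP[].
  by apply/(subsetP sJ')/(subsetP sAJ); rewrite inE xC.
have pE : p \in ground M := subsetP sQE p pQ.
have pS' : p \notin S' by rewrite !inE eqxx.
have pB' : p \notin B'.
  apply/negP => /(subsetP sB'); rewrite !in_setU (negPf pS') (negPf (nQ p pQ).2) /= inE.
  by rewrite (negPf (nQ p pQ).1) andbF.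
move=> y /setDP[yC yZ]; case yB': (y \in B'); last first.
  by apply/negP => /fadj_alt; rewrite (negPf pB') yB'.
apply/negP => a; move: nS; have -> : J :|: S = p |: (J :|: S').
  by rewrite setUCA /S' setD1K.
rewrite (fadj_span bB' sJB') // => /existsP[]; exists y; rewrite a andbT !in_setD in_setU yB' andbT.
rewrite negb_or; apply/andP; split.
  apply/negP => /(subsetP sJ); rewrite in_setU (negPf yZ) inE yC //.
by apply/negP => /(subsetP sS'Q) /nQ[_]; rewrite yC.
Qed.

(** Relative to [B :\: C], either [Q :\: X] is dependent over [C :\: X] or [Q :&: X] is dependent
    over [C :&: X]; the ports found are then detached from the part of [C] on the opposite side of
    [X]. *)
Lemma dependent_ports_out (T : finType) (M : matroid T) (B C X Q : {set T}) :
  base M B -> [disjoint Q & B] -> [disjoint Q & C] -> Q \subset ground M -> C \subset ground M ->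
  lambda M X < #|Q| ->
  exists S Y : {set T}, [/\ S \subset Q, S != set0, Y = C :&: X \/ Y = C :\: X &
    forall p, p \in S ->
    exists B', [/\ base M B', B' :\: (C :|: S :\ p) = B :\: (C :|: S :\ p) &
      forall y, y \in Y -> ~~ fadj M B' p y]].
Proof.
move=> bB dQB dQC sQE sCE ltX; set A := B :\: C.
have side (Z Q' : {set T}) : Z \subset C -> Q' \subset Q ->
    rank M (A :|: Z :|: Q') < rank M (A :|: Z) + #|Q'| ->
    exists S : {set T}, [/\ S \subset Q, S != set0 & forall p, p \in S ->
    exists B', [/\ base M B', B' :\: (C :|: S :\ p) = B :\: (C :|: S :\ p) &
      forall y, y \in C :\: Z -> ~~ fadj M B' p y]].
  move=> sZ sQ' lt.
  have [S [sS nS hS]] := dependent_side bB (disjointWl sQ' dQB) (disjointWl sQ' dQC)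
    (subset_trans sQ' sQE) sZ lt.
  by exists S; split=> //; apply: subset_trans sS sQ'.
case: (ltnP (rank M (A :|: C :\: X :|: Q :\: X)) (rank M (A :|: C :\: X) + #|Q :\: X|)) => [lt|ge1].
  have [S [sS nS hS]] := side _ _ (subsetDl _ _) (subsetDl _ _) lt.
  exists S, (C :&: X); split=> //; first by left.
  by move=> p /hS[B' [b1 b2 b3]]; exists B'; split=> // y yY; apply: b3; rewrite setDDr setDv set0U.
case: (ltnP (rank M (A :|: C :&: X :|: Q :&: X)) (rank M (A :|: C :&: X) + #|Q :&: X|)) => [lt|ge2].
  have [S [sS nS hS]] := side _ _ (subsetIl _ _) (subsetIl _ _) lt.
  exists S, (C :\: X); split=> //; first by right.
  by move=> p /hS[B' [b1 b2 b3]]; exists B'; split=> // y yY; apply: b3; rewrite setDIr setDv set0U.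
(* If both are independent, the ranks with the ports are at most [r (E :\: X) + #|A :&: X|] and
   [r X + #|A :\: X|]. The two sets without the ports together span and both contain [A], so
   submodularity gives [#|Q| <= lambda M X]. *)
exfalso.
have sAE : A \subset ground M := subset_trans (subsetDl _ _) (base_sub bB).
have up1 : rank M (A :|: C :\: X :|: Q :\: X) <= rank M (ground M :\: X) + #|A :&: X|.
  apply: leq_trans (rankU_card _ _ _); apply: rankS; apply/subsetP => z.
  rewrite !(in_setU, in_setD, in_setI) -orbA; case: (z \in X) => /=; first by rewrite !orbF andbT.
  case: (boolP (z \in A)) => [/(subsetP sAE)->//|_].
  by case/or3P => [/andP[_ /(subsetP (base_sub bB))->]|/(subsetP sCE)->|/(subsetP sQE)->].
have up2 : rank M (A :|: C :&: X :|: Q :&: X) <= rank M X + #|A :\: X|.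
  apply: leq_trans (rankU_card _ _ _); apply: rankS; apply/subsetP => z.
  rewrite !(in_setU, in_setD, in_setI); case: (z \in X) => //=; by rewrite !andbF !orbF.
have := rank_submod M (A :|: C :\: X) (A :|: C :&: X).
have -> : rank M (A :|: C :\: X :|: (A :|: C :&: X)) = rank M (ground M).
  apply: (rank_base_sup bB); apply/subsetP => z zB; rewrite !inE zB andbT.
  by case: (z \in C); case: (z \in X).
have : #|A| <= rank M ((A :|: C :\: X) :&: (A :|: C :&: X)).
  apply: leq_rank; first by rewrite subsetI !subsetUl.
  by apply: indepS (base_indep bB); apply: subsetDl.
have := lambdaE M X; have := cardsID X A; have := cardsID X Q.
by lia.
Qed.

(** In the dual the ports lie outside the base, while [lambda] and the fundamental graph are
    unchanged. *)
Lemma dependent_ports_in (T : finType) (M : matroid T) (B C X Q : {set T}) :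
  base M B -> Q \subset B -> [disjoint Q & C] -> C \subset ground M -> X \subset ground M ->
  lambda M X < #|Q| ->
  exists S Y : {set T}, [/\ S \subset Q, S != set0, Y = C :&: X \/ Y = C :\: X &
    forall p, p \in S ->
    exists B', [/\ base M B', B' :\: (C :|: S :\ p) = B :\: (C :|: S :\ p) &
      forall y, y \in Y -> ~~ fadj M B' p y]].
Proof.
move=> bB sQB dQC sCE sXE ltX.
have sQE := subset_trans sQB (base_sub bB).
have [|||S [Y [sS nS hY hS]]] := @dependent_ports_out _ (dual M) (ground M :\: B) C X Q _ _ dQC sQE sCE.
- exact: base_dualC.
- by rewrite -setI_eq0 setIDA setDIl (eqP (_ : Q :\: B == set0)) ?set0I // setD_eq0.
- by rewrite lambda_dual.
exists S, Y; split=> // p /hS[B' [bB' eB' nB']].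
have sB' : B' \subset ground M := base_sub bB'.
have b2 : base M (ground M :\: B') by rewrite -base_dual.
exists (ground M :\: B'); split=> //.
  apply/setP => z; have := congr1 (fun U : {set T} => z \in U) eB'.
  rewrite !in_setD; case: (z \in _) => //= ->.
  by case: (boolP (z \in B)) => [/(subsetP (base_sub bB))->|_] //=; case: (z \in ground M).
move=> y /nB'; rewrite -{1}(_ : ground M :\: (ground M :\: B') = B') ?fadj_dual //.
by rewrite setDDr setDv set0U (setIidPr sB').
Qed.

End Ports.

(** * Rooted decompositions and depth *)

Section Depth.
Variables (T : finType) (M : matroid T) (K : nat).
Hypothesis K0 : 0 < K.
Implicit Types (B C D X Y V U A : {set T}) (x y c : T).
Local Notation E := (ground M).

(* A rooted decomposition of height d of Y, given by its top partition into the
   fibres of f; a union of parts is the preimage of a set A of labels. *)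
Fixpoint dec (d : nat) (Y : {set T}) : Prop :=
  if d is d'.+1 then
    exists f : T -> T, (forall A, lambda M [set x in Y | f x \in A] <= K) /\
      forall a, dec d' [set x in Y | f x == a]
  else #|Y| <= 1.

Lemma dec_small d Y : #|Y| <= 1 -> dec d Y.
Proof.
elim: d Y => //= d IHd Y cY.
have sub (P : pred T) : #|[set x in Y | P x]| <= 1.
  by apply: leq_trans cY; apply/subset_leq_card/subsetP => x; rewrite inE => /andP[].
exists id; split=> [A|a]; last exact: IHd.
by apply: leq_trans (lambda_card _ _) (leq_trans (sub _) K0).
Qed.

Lemma lambda0 : lambda M set0 = 0.
Proof. by apply/eqP; rewrite -leqn0 -(@cards0 T) lambda_card. Qed.

Lemma decS d Y : lambda M Y <= K -> dec d Y -> dec d.+1 Y.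
Proof.
move=> lY dY; have [->|[y yY]] := set_0Vmem Y; first by apply: dec_small; rewrite cards0.
exists (fun => y); split=> [A|a].
  case: (y \in A); first by rewrite (_ : [set x in Y | true] = Y) //; apply/setP => z; rewrite !inE andbT.
  by rewrite (_ : [set x in Y | false] = set0) ?lambda0 //; apply/setP => z; rewrite !inE andbF.
case: (y == a); first by rewrite (_ : [set x in Y | true] = Y) //; apply/setP => z; rewrite !inE andbT.
rewrite (_ : [set x in Y | false] = set0); first by apply: dec_small; rewrite cards0.
by apply/setP => z; rewrite !inE andbF.
Qed.

Lemma decU d Y Y' : [disjoint Y & Y'] -> lambda M Y <= K -> lambda M Y' <= K ->
  lambda M (Y :|: Y') <= K -> dec d Y -> dec d Y' -> dec d.+1 (Y :|: Y').
Proof.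
move=> dYY lY lY' lU dY dY'.
have [eY|[y yY]] := set_0Vmem Y; first by rewrite eY set0U; apply: decS.
have [eY|[y' yY']] := set_0Vmem Y'; first by rewrite eY setU0; apply: decS.
have nyy : y != y' by apply: contraTneq yY' => <-; rewrite (disjointFr dYY).
exists (fun x => if x \in Y then y else y'); split=> [A|a].
  set S := [set x in _ | _].
  suff : [\/ S = set0, S = Y, S = Y' | S = Y :|: Y'].
    by case=> ->; rewrite ?lambda0.
  case yA: (y \in A); case yA': (y' \in A); [apply: Or44 | apply: Or42 | apply: Or43 | apply: Or41];
  apply/setP => z; rewrite !inE; case: (boolP (z \in Y)) => zY //=; rewrite ?yA ?yA' ?andbT ?andbF //.
  by rewrite (disjointFr dYY zY).
set S := [set x in _ | _].
suff : [\/ S = set0, S = Y | S = Y'] by case=> -> //; apply: dec_small; rewrite cards0.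
case: (eqVneq y a) => [ya|ya]; last case: (eqVneq y' a) => [ya'|ya']; [apply: Or32 | apply: Or33 | apply: Or31];
apply/setP => z; rewrite !inE; case: (boolP (z \in Y)) => zY //=.
- by rewrite ya eqxx.
- by rewrite -ya eq_sym (negPf nyy) andbF.
- by rewrite (negPf ya) (disjointFr dYY zY).
- by rewrite ya' eqxx andbT.
- by rewrite (negPf ya).
- by rewrite (negPf ya') andbF.
Qed.

(** Otherwise partition [D] into [[set c]] and the components of [D :\ c]. A union of components has
    connectivity at most that of [D :\ c], so a union of parts exceeds [lambda M D] by at most two:
    one for removing [c], one for putting it back. *)
Lemma big_component B D c d : base M B -> D \subset E -> (lambda M D).+2 <= K ->
  ~ dec d.+1 D ->
  exists2 x, x \in D :\ c & ~ dec d (component M B (D :\ c) x).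
Proof.
move=> bB sD lD nD; apply: contra_notP nD => no.
set U := D :\ c in no *; set e := within M B U.
have sym : connect_sym e := @within_sym T M B U.
have sUE : U \subset E by apply: subset_trans (subsetDl _ _) sD.
have all x : x \in U -> dec d (component M B U x).
  by move=> xU; apply: contrapT => n; apply: no; exists x.
(* As [c] is not in [U], it is isolated in [e] and is its own root; hence the fibres of [root e] are
   the parts of the intended partition. *)
have cc y : connect e c y -> y = c.
  by case/connectP => [[|z p]] //= /andP[/and3P[]]; rewrite !inE eqxx.
have rc : root e c = c by apply: cc; apply: connect_root.
have lU : lambda M U <= (lambda M D).+1.
  apply: leq_trans (lambdaD_le _ sD) _; rewrite -addn1 leq_add2l.
  by apply: leq_trans (lambda_card _ _) _; rewrite cards1.
exists (root e); split=> [A|a].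
  pose V := [set x in U | root e x \in A].
  have sV : V \subset U by apply/subsetP => x; rewrite inE => /andP[].
  have lV : lambda M V <= lambda M U.
    apply: lambda_separated bB sUE sV _ => x y; rewrite inE => /andP[xU xA] /setDP[yU yV].
    apply: contra yV => a; rewrite inE yU /=.
    suff -> : root e y = root e x by [].
    by apply/eqP; rewrite root_connect // sym connect1 //; apply/and3P.
  have lc : lambda M [set c] <= 1 by apply: leq_trans (lambda_card _ _) _; rewrite cards1.
  have [-> | ->] : [set x in D | root e x \in A] = V \/ [set x in D | root e x \in A] = V :|: [set c].
  - case cA: ((c \in D) && (c \in A)); [right|left]; apply/setP => x; rewrite !inE.
      case: (eqVneq x c) => [->|]; last by rewrite orbF.
      by rewrite rc cA orbT.
    by case: (eqVneq x c) => [->|]; rewrite ?rc ?cA.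
  - by apply: leq_trans lV (leq_trans lU (leq_trans _ lD)).
  apply: leq_trans (lambdaU_le _ _ _) _; apply: leq_trans lD.
  by apply: leq_trans (leq_add (leq_trans lV lU) lc) _; rewrite addn1.
case: (pselect (exists2 x, x \in U & root e x = a)) => [[x xU xa]|nx]; last first.
  apply: dec_small; rewrite -(cards1 c); apply/subset_leq_card/subsetP => y.
  rewrite !inE => /andP[yD /eqP ya]; apply/negPn/negP => yc; apply: nx; exists y => //.
  by rewrite !inE yc.
suff -> : [set y in D | root e y == a] = component M B U x by apply: all.
apply/setP => y; rewrite !inE -xa root_connect // sym.
case: (eqVneq y c) => [->|] //=; apply/negbTE/negP => /andP[_]; rewrite sym => /cc xc.
by move: xU; rewrite xc !inE eqxx.
Qed.

Section Split.
Variable w : nat.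

(** The sets displayed by the edges of a rooted branch-decomposition of width at most [w]. The bound
    is strict because the width of an edge is its connectivity plus one. *)
Inductive bdec : {set T} -> Prop :=
| bdec_leaf X : #|X| <= 1 -> X \subset E -> lambda M X < w -> bdec X
| bdec_node X X' : bdec X -> bdec X' -> [disjoint X & X'] -> lambda M (X :|: X') < w ->
    bdec (X :|: X').

Lemma bdec_lambda X : bdec X -> lambda M X < w. Proof. by case. Qed.

Lemma bdec_sub X : bdec X -> X \subset E.
Proof. by elim=> // {}X X' _ s _ s' _ _; rewrite subUset s. Qed.

(** Descend the branch-decomposition to a child whose trace on [C] has no decomposition of height
    [d.+1]. When neither child qualifies, one of the traces has none of height [d], since otherwise
    their union would have one of height [d.+1]. The rest of [C] is deep because [C] has none of
    height [d.+2]. *)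
Lemma split_large C d : C \subset E -> lambda M C + w <= K -> bdec E -> ~ dec d.+2 C ->
  exists X, [/\ X \subset E, lambda M X < w, ~ dec d (C :&: X) & ~ dec d (C :\: X)].
Proof.
move=> sC lC bE nC.
have lK : lambda M C <= K by apply: leq_trans lC; apply: leq_addr.
have lI X : lambda M X < w -> lambda M (C :&: X) <= K.
  by move=> lX; apply: leq_trans (leq_trans (lambdaI_le _ _ _) _) lC; rewrite leq_add2l ltnW.
have lD X : lambda M X < w -> lambda M (C :\: X) <= K.
  by move=> lX; apply: leq_trans (leq_trans (lambdaD_le _ sC) _) lC; rewrite leq_add2l ltnW.
have pieces X : lambda M X < w -> ~ dec d.+1 (C :&: X) \/ ~ dec d.+1 (C :\: X).
  move=> lX; apply: contrapT => /not_orP[/contrapT d1 /contrapT d2]; apply: nC.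
  rewrite -(setID C X); apply: decU => //; rewrite ?setID ?lI ?lD //.
  by rewrite -setI_eq0; apply/eqP/setP => z; rewrite !inE; case: (z \in X); rewrite ?andbF.
suff : forall X, bdec X -> ~ dec d.+1 (C :&: X) ->
    exists X, [/\ X \subset E, lambda M X < w, ~ dec d (C :&: X) & ~ dec d (C :\: X)].
  move/(_ E bE); apply; rewrite (setIidPl sC) => dC; apply: nC; exact: decS.
move=> X; elim=> {X} [X cX _ lX []|X X' bX IHX bX' IHX' dX lX nX].
  apply: dec_small; apply: leq_trans cX; exact/subset_leq_card/subsetIr.
case: (pselect (dec d.+1 (C :&: X))) => [dX1|/IHX //].
case: (pselect (dec d.+1 (C :&: X'))) => [dX2|/IHX' //].
have l1 := bdec_lambda bX; have l2 := bdec_lambda bX'.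
have found Y : bdec Y -> dec d.+1 (C :&: Y) -> ~ dec d (C :&: Y) ->
    exists X, [/\ X \subset E, lambda M X < w, ~ dec d (C :&: X) & ~ dec d (C :\: X)].
  move=> bY dY nY; have lY := bdec_lambda bY; exists Y; split=> //; first exact: bdec_sub.
  by case: (pieces Y lY) => // n dD; apply: n; apply: decS dD; apply: lD.
case: (pselect (dec d (C :&: X))) => [d1|n1]; last exact: found n1.
case: (pselect (dec d (C :&: X'))) => [d2|n2]; last exact: found n2.
case: nX; rewrite setIUr; apply: decU => //; rewrite ?lI // -?setIUr ?lI //.
by apply: disjointWl (subsetIr _ _) (disjointWr (subsetIr _ _) dX).
Qed.

End Split.
End Depth.

(** * Sticks *)


Lemma first_split (V : Type) (b : pred V) (l : seq V) :
  ~~ all b l -> exists l1 x l2, [/\ l = l1 ++ x :: l2, all b l1 & ~~ b x].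
Proof.
elim: l => //= x l IHl; case bx: (b x) => /=.
  by move/IHl => [l1 [y [l2 [-> h ny]]]]; exists (x :: l1), y, l2; split; rewrite //= bx.
by move=> _; exists [::], x, l; rewrite bx.
Qed.

(** * Induced paths and their prolongation *)

Section InducedPaths.
Variable T : eqType.
Implicit Types (e : rel T) (a : pred T) (s q : seq T) (p x y z u : T).

Fixpoint ipath e s : bool :=
  if s is x :: s' then
    [&& ipath e s', x \notin s' & if s' is y :: s'' then e x y && all (fun z => ~~ e x z) s'' else true]
  else true.

Lemma ipath_take e s n : ipath e s -> ipath e (take n s).
Proof.
elim: s n => [|x s IHs] [|n] //= /and3P[ips xs h]; rewrite IHs //=.
apply/andP; split; first by apply: contra xs; apply: mem_take.
case: s {IHs ips xs} h n => [|y s] // /andP[exy /allP h] [|n] //=.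
by rewrite exy /=; apply/allP => z /mem_take/h.
Qed.

(** The second argument ranges over the tail only: the head of a stick is its port, whose
    neighbourhood may change with the base. *)
Lemma ipath_eq e e' s :
  (forall x y, x \in s -> y \in behead s -> e' x y = e x y) -> ipath e s -> ipath e' s.
Proof.
elim: s => //= x s IHs ee /and3P[ips -> h]; rewrite IHs //=; last first.
  by move=> u v us vs; apply: ee; [rewrite inE us orbT | apply: mem_behead].
case: s {IHs ips} ee h => //= y s ee /andP[exy /allP h]; rewrite ee ?inE ?eqxx // exy /=.
by apply/allP => z zs; rewrite ee ?inE ?eqxx ?zs ?orbT // h.
Qed.

Lemma last_split a s : has a s -> exists s1 x s2, [/\ s = s1 ++ x :: s2, a x & ~~ has a s2].
Proof.
elim: s => //= x s IHs; case: (boolP (has a s)) => [/IHs[s1 [y [s2 [-> ay h]]]] _|h].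
  by exists (x :: s1), y, s2.
by rewrite orbF => ax; exists [::], x, s.
Qed.

(* The shortcut from p jumps to its last neighbour on the walk q, so that the
   rest of the walk stays away from p. *)
Lemma ipath_extend e a p s q : symmetric e -> ipath e (p :: s) -> path e p q -> uniq (p :: q) ->
  a (last p q) -> (forall z, z \in q -> z \notin s /\ forall u, u \in s -> ~~ e u z) ->
  (forall u, u \in s -> ~~ a u) ->
  exists z s', [/\ ipath e (z :: s'), a z /\ (forall u, u \in s' -> ~~ a u),
    z \in p :: q, {subset s' <= (p :: q) ++ s} & size s + ~~ a p <= size s'].
Proof.
move=> syme; have [n] := ubnP (size q); elim: n p s q => // n IHn p s q ltn ip pth unq al hq hs.
case ap: (a p) => /=.
  exists p, s; split; rewrite ?addn0 ?mem_head //.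
  by move=> u us; rewrite (mem_cat u (p :: q) s) us orbT.
have hasq : has (e p) q.
  case: q al pth {hq ltn unq} => [|x q] /=; first by rewrite ap.
  by move=> _ /andP[-> _].
have [q1 [x [q2 [eq epx nq2]]]] := last_split hasq.
have xq : x \in q by rewrite eq mem_cat inE eqxx orbT.
have sq2 z : z \in q2 -> z \in q by move=> zq; rewrite eq mem_cat inE zq !orbT.
have [|||||||z [s' [i1 [i2 i3] i4 i5 i6]]] := IHn x (p :: s) q2.
- by move: ltn; rewrite eq size_cat /=; lia.
- have [xs ns] := hq x xq; have /andP[pq _] : (p \notin q) && uniq q := unq.
  have -> : ipath e (x :: p :: s) = [&& ipath e (p :: s), x \notin p :: s & e x p && all (fun z => ~~ e x z) s].
    by [].
  rewrite ip inE negb_or xs andbT syme epx /=; apply/andP; split.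
    by apply: contraNneq pq => <-.
  by apply/allP => u us; rewrite syme ns.
- by move: pth; rewrite eq cat_path /= => /and3P[].
- by move: unq; rewrite eq /= cat_uniq => /and4P[_ _ _].
- by move: al; rewrite eq last_cat.
- move=> z zq2; have zq := sq2 z zq2; have [zs nz] := hq z zq; split.
    rewrite inE negb_or zs andbT; apply: contraTneq unq => <-; by rewrite /= zq.
  move=> u; rewrite inE => /orP[/eqP->|]; last exact: nz.
  by apply: contra nq2 => epz; apply/hasP; exists z.
- by move=> u; rewrite inE => /orP[/eqP->|]; [rewrite ap | apply: hs].
exists z, s'; split=> //.
- by move: i4; rewrite !inE => /orP[/eqP->|/sq2->]; rewrite ?xq !orbT.
- move=> u /i5; rewrite (mem_cat u (x :: q2)) (mem_cat u (p :: q)) !inE -!orbA.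
  by case/or4P => [/eqP->|/sq2->|/eqP->|->]; rewrite ?xq ?eqxx ?orbT.
by apply: leq_trans i6; rewrite /= addn1; apply: leq_addr.
Qed.

(** The walk is cut just before its first visit to [a]. *)
Lemma path_enter e a p q : path e p q -> ~~ a p -> a (last p q) ->
  exists q', [/\ path e p q', all (predC a) (p :: q'), {subset q' <= q} & exists2 c, a c & e (last p q') c].
Proof.
elim: q p => [|x q IHq] p /=; first by move=> _ /negPf->.
move=> /andP[epx pth] nap al; case ax: (a x).
  by exists [::]; split; rewrite //= ?nap //; exists x.
have [||q' [h1 h2 h3 h4]] := IHq x pth; rewrite ?ax //.
exists (x :: q'); split=> //=; rewrite ?epx ?nap //.
by move=> u; rewrite !inE => /orP[->|/h3->]; rewrite ?orbT.
Qed.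

End InducedPaths.

Section Sticks.
Variables (T : finType) (M : matroid T).
Implicit Types (B C D U : {set T}) (x y z c : T) (s u : T * seq T) (L : seq (T * seq T)).
Local Notation E := (ground M).

(* s.1 is the port; s.2 lists the rest of the stick, starting next to the port. *)
Definition stick B C s : Prop :=
  [/\ ipath (fadj M B) (s.1 :: s.2), {in s.1 :: s.2, forall x, (x \in E) && (x \notin C)},
      exists2 c, c \in C & fadj M B s.1 c &
      forall x c, x \in s.2 -> c \in C -> ~~ fadj M B x c].

(** Of an earlier stick, only the port may be adjacent to the port of a later one. Later ports may
    enter or leave the base, and this condition shields the rest of the earlier sticks from that. *)
Definition before B : rel (T * seq T) :=
  [rel s s' | (s'.1 \notin s.1 :: s.2) && all (fun x => ~~ fadj M B x s'.1) s.2].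

Definition longer : rel (T * seq T) := [rel s s' | size s'.2 <= size s.2].

Definition sticks B C L : Prop :=
  [/\ forall s, s \in L -> stick B C s, pairwise (before B) L & pairwise longer L].

Lemma gconnected_ports B C U : gconnected M B C -> C \subset U ->
  (forall x, x \in U -> x \in C \/ exists2 c, c \in C & fadj M B x c) -> gconnected M B U.
Proof.
move=> con sCU h.
have toC x : x \in U -> exists2 c, c \in C & connect (within M B U) x c.
  move=> xU; case: (h x xU) => [xC|[c cC a]]; first by exists x; rewrite ?connect0.
  by exists c => //; apply: connect1; apply/and3P; split=> //; apply: (subsetP sCU).
move=> x y /toC[c cC xc] /toC[c' c'C yc'].
apply: connect_trans xc _; rewrite within_sym; apply: connect_trans yc' _.
by rewrite within_sym; apply: connect_withinS sCU (con _ _ _ _).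
Qed.

(** The set [C :|: D :|: [set s.1]] is connected for [B], hence for [B'], and so contains a walk
    from the port of [s] to [C1] along which [s] is prolonged. The sticks of [L2] are given up,
    since their ports may be in [D]. Those of [L1] stay sticks, as their elements other than the
    port see neither [C] nor [D]; the ones longer than [s] are kept. *)
Lemma advance B B' C C1 D L1 s L2 :
  base M B -> base M B' -> C \subset E -> C1 \subset C -> C1 != set0 -> gconnected M B C ->
  sticks B C (L1 ++ s :: L2) -> (forall x, x \in D -> exists2 s', s' \in L2 & x = s'.1) ->
  B' :\: (C :|: D) = B :\: (C :|: D) ->
  (forall u, u \in L1 -> exists2 c, c \in C1 & fadj M B' u.1 c) ->
  (forall c, c \in C1 -> ~~ fadj M B' s.1 c) ->
  exists s', size s'.2 = (size s.2).+1 /\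
    sticks B' C1 ([seq u <- L1 | size s.2 < size u.2] ++ [:: s']).
Proof.
move=> bB bB' sCE sC1 /set0Pn[c1 c1C1] conC [okL befL lonL] hD eBD adj1 nadj.
set L := L1 ++ s :: L2 in okL befL lonL.
have sL : s \in L by rewrite mem_cat inE eqxx orbT.
have L1L u : u \in L1 -> u \in L by rewrite mem_cat => ->.
have L2L u : u \in L2 -> u \in L by rewrite mem_cat inE => ->; rewrite !orbT.
have [bef1 befs bef12] : [/\ forall u, u \in L1 -> before B u s,
    forall v, v \in L2 -> before B s v & forall u v, u \in L1 -> v \in L2 -> before B u v].
  move: befL; rewrite pairwise_cat /= => /and3P[/allrelP al _ /andP[/allP a2 _]]; split.
  - by move=> u uL1; apply: al; rewrite ?inE ?eqxx.
  - exact: a2.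
  by move=> u v uL1 vL2; apply: al => //; rewrite inE vL2 orbT.
have befD u x : u \in L1 \/ u = s -> x \in D ->
    x \notin u.1 :: u.2 /\ forall v, v \in u.2 -> ~~ fadj M B v x.
  move=> hu /hD[s' s'L2 ->].
  have /andP[h1 /allP h2] : before B u s' by case: hu => [uL1|->]; [apply: bef12 | apply: befs].
  by split.
have out u z : u \in L1 \/ u = s -> z \in u.1 :: u.2 -> z \notin C :|: D.
  move=> hu zu; have uL : u \in L by case: hu => [/L1L|->].
  rewrite in_setU negb_or; have [_ h _ _] := okL u uL; case/andP: (h z zu) => _ -> /=.
  by apply/negP => zD; have [/negP] := befD u z hu zD.
have frozen u z y : u \in L1 \/ u = s -> z \in u.2 ->
    fadj M B' z y = (y \notin C :|: D) && fadj M B z y.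
  move=> hu zu; apply: (fadj_change y bB bB' (esym eBD)).
    by apply: out hu _; rewrite inE zu orbT.
  move=> c; rewrite in_setU => /orP[cC|cD]; last by have [_ h] := befD u c hu cD; apply: h.
  have uL : u \in L by case: hu => [/L1L|->].
  by have [_ _ _ h] := okL u uL; apply: h.
have ip u : u \in L1 \/ u = s -> ipath (fadj M B') (u.1 :: u.2).
  move=> hu; have uL : u \in L by case: hu => [/L1L|->].
  have [h _ _ _] := okL u uL; apply: ipath_eq h => x y xu yu.
  by rewrite fadj_sym (frozen u) // (out u) // fadj_sym.
have U2 : gconnected M B' (C :|: D :|: [set s.1]).
  apply: (gconnected_change bB bB').
  - rewrite !subUset sCE sub1set /=; apply/andP; split.
      apply/subsetP => x /hD[s' /L2L/okL[_ h _ _] ->].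
      by case/andP: (h s'.1 (mem_head _ _)).
    by have [_ h _ _] := okL s sL; case/andP: (h s.1 (mem_head _ _)).
  - by rewrite -(setDDl B) -(setDDl B') eBD.
  apply: (gconnected_ports conC); first by rewrite -setUA subsetUl.
  move=> x; rewrite !in_setU in_set1 => /orP[/orP[xC|/hD[s' /L2L/okL[_ _ h _] ->]]|/eqP->].
  - by left.
  - by right.
  by right; have [_ _ h _] := okL s sL.
set U := C :|: D :|: [set s.1] in U2.
have sU : s.1 \in U by rewrite !in_setU in_set1 eqxx !orbT.
have sC1' : s.1 \notin C1.
  have := out s s.1 (or_intror erefl) (mem_head _ _); rewrite in_setU negb_or => /andP[+ _].
  by apply: contra; apply: (subsetP sC1).
have c1U : c1 \in U by rewrite !in_setU (subsetP sC1).
have /connectP[q0 pq0 lq0] := U2 _ _ sU c1U.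
have lq0' : last s.1 q0 \in C1 by rewrite -lq0.
have [q1 [pq1 aq1 _ [c cC1 lc]]] := path_enter (a := mem C1) pq0 sC1' lq0'.
have : path (fadj M B') s.1 q1 by apply: sub_path pq1 => x y /and3P[].
have q1U z : z \in q1 -> z \in U.
  elim: q1 (s.1) pq1 {aq1 lc} => // y q1 IHq x /= /andP[/and3P[_ yU _] pq1].
  by rewrite inE => /orP[/eqP->//|]; apply: IHq pq1.
(* The candidates for the new port: elements outside [C1] with a neighbour in it. The old port is
   not one of them ([nas]), so the new path is strictly longer. *)
pose a y := (y \notin C1) && [exists c in C1, fadj M B' y c].
have : a (last s.1 q1).
  rewrite /a; have := allP aq1 _ (mem_last _ _) => /= -> /=.
  by apply/existsP; exists c; rewrite [_ \in _]cC1; case/and3P: lc.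
have aq1' : forall z, z \in q1 -> z \notin C1.
  by move=> z zq; have := allP aq1 z; rewrite inE zq orbT => /(_ isT).
move=> al pth; case: (shortenP pth) al => q {}pth unq sq al {pq1 aq1 lc}.
have qCD z : z \in q -> z \in C :|: D.
  move=> zq; have := q1U z (sq z zq); rewrite /U in_setU in_set1 => /orP[//|/eqP zs].
  by move: unq; rewrite /= -zs zq.
have nas : ~~ a s.1.
  by rewrite /a negb_and; apply/orP; right; apply/existsP => -[d /andP[dC1]]; apply/negP/nadj.
have hs := or_intror (erefl s) : s \in L1 \/ s = s.
have [||z [r [i1 [i2 i3] i4 i5 i6]]] := ipath_extend (@fadj_sym _ M B') (ip s hs) pth unq al.
- move=> z /qCD zCD; split.
    by apply/negP => zs; move: (out s z hs); rewrite inE zs orbT zCD => /(_ isT).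
  by move=> u us; rewrite (frozen s) // zCD.
- move=> u us; rewrite /a negb_and; apply/orP; right; apply/existsP => -[d /andP[dC1]].
  by rewrite (frozen s) // in_setU (subsetP sC1).
rewrite nas addn1 in i6.
have zCD : z \in C :|: D.
  move: i4; rewrite inE => /orP[/eqP zs|/qCD //]; by move: i2 nas; rewrite zs => ->.
(* The path found may be longer than required; trimmed to exactly one more element, it is no longer
   than the sticks kept from [L1], so the order by length persists. *)
exists (z, take (size s.2).+1 r); rewrite /= size_takel //; split=> //.
have sUE x : x \in C :|: D -> x \in E.
  rewrite in_setU => /orP[/(subsetP sCE)//|/hD[s' /L2L/okL[_ h _ _] ->]].
  by case/andP: (h s'.1 (mem_head _ _)).
have rE x : x \in r -> (x \in E) && (x \notin C1).
  move/i5; rewrite mem_cat inE -orbA => /or3P[/eqP->|xq|xs].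
  - by rewrite sC1' andbT; have [_ h _ _] := okL s sL; case/andP: (h s.1 (mem_head _ _)).
  - by rewrite sUE ?qCD //= aq1' // sq.
  have [_ h _ _] := okL s sL; have /andP[-> xC] : (x \in E) && (x \notin C) by apply: h; rewrite inE xs orbT.
  by apply: contra xC; apply: (subsetP sC1).
split.
- move=> u; rewrite mem_cat mem_filter inE => /orP[/andP[_ uL1]|/eqP->].
    have [h1 h2 h3 h4] := okL u (L1L u uL1); split.
    + by apply: ip; left.
    + move=> x xu; case/andP: (h2 x xu) => -> xC /=; apply: contra xC; exact: (subsetP sC1).
    + exact: adj1.
    move=> v d vu dC1; rewrite (frozen u) //; last by left.
    by rewrite in_setU (subsetP sC1).
  split.
  + exact: (@ipath_take _ _ (z :: r) (size s.2).+2).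
  + move=> x; rewrite inE => /orP[/eqP->|/mem_take/rE //].
    by rewrite sUE //=; case/andP: i2.
  + by case/andP: i2 => _ /existsP[d /andP[dC1 ad]]; exists d.
  move=> v d /mem_take vr dC1; have := i3 v vr; rewrite /a; case/andP: (rE v vr) => _ -> /=.
  by rewrite negb_exists => /forallP/(_ d); rewrite dC1.
- rewrite pairwise_cat /= andbT; apply/andP; split.
    apply/allrelP => u v; rewrite mem_filter inE => /andP[_ uL1] /eqP->.
    apply/andP; split.
      by apply/negP => zu; have := out u z (or_introl uL1) zu; rewrite zCD.
    by apply/allP => x xu; rewrite (frozen u) ?zCD //; left.
  apply: pairwise_filter.
  have : pairwise (before B) L1 by move: befL; rewrite pairwise_cat => /and3P[].
  apply: sub_in_pairwise (allss L1) => u v uL1 vL1 /andP[h1 /allP h2].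
  apply/andP; split=> //; apply/allP => x xu; rewrite (frozen u) //; last by left.
  by rewrite (negPf (h2 x xu)) andbF.
rewrite pairwise_cat /= andbT; apply/andP; split.
  apply/allrelP => u v; rewrite mem_filter inE => /andP[su _] /eqP->.
  by rewrite /longer /= size_takel.
apply: pairwise_filter.
by move: lonL; rewrite pairwise_cat => /and3P[].
Qed.

End Sticks.

(** * Growing sticks *)


Section Steps.
Variables (T : finType) (M : matroid T) (w : nat).
Hypothesis w0 : 0 < w.
Implicit Types (B C D U X : {set T}) (x y z c : T) (s u : T * seq T) (L : seq (T * seq T)).
Local Notation E := (ground M).
Local Notation beta := (2 * w).

(* With fewer than beta sticks, one stick of size l + 1 outweighs any collection
   of sticks of size at most l. *)
Definition potential L : nat := \sum_(s <- L) beta ^ size s.2.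

(** With [l = size s.2], there are fewer than [beta] dropped sticks and each weighs at most
    [beta ^ l], whereas [s'] weighs [beta ^ l.+1]. *)
Lemma potential_advance L1 s L2 s' : size (L1 ++ s :: L2) < beta ->
  pairwise (@longer T) (L1 ++ s :: L2) -> size s'.2 = (size s.2).+1 ->
  potential (L1 ++ s :: L2) <
  potential ([seq u <- L1 | size s.2 < size u.2] ++ [:: s']).
Proof.
move=> szL lon ss'; rewrite /potential big_cat big_cons [X in _ < X]big_cat big_cons big_nil /= ss'.
have lon2 : all (fun u => size u.2 <= size s.2) L2.
  by move: lon; rewrite pairwise_cat /= => /and3P[_ _ /andP[]].
have pw l l' : l <= l' -> beta ^ l <= beta ^ l' by move=> ll; rewrite leq_pexp2l //; lia.
have le2 : \sum_(u <- L2) beta ^ size u.2 <= size L2 * beta ^ size s.2.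
  elim: L2 lon2 {szL lon} => [|u L2 IH] /=; first by rewrite big_nil.
  by case/andP => us /IH le; rewrite big_cons (mulSn (size L2)) leq_add // pw.
have le1 : \sum_(u <- L1) beta ^ size u.2 <=
    \sum_(u <- [seq u <- L1 | size s.2 < size u.2]) beta ^ size u.2 + size L1 * beta ^ size s.2.
  elim: L1 {szL lon} => [|u L1 IH] /=; first by rewrite big_nil.
  rewrite big_cons (mulSn (size L1)); case: ltnP => us; rewrite ?big_cons; first by lia.
  by have := pw _ _ us; lia.
rewrite size_cat /= in szL; rewrite expnS.
have : (size L1 + (size L2).+1) * beta ^ size s.2 < beta * beta ^ size s.2.
  by rewrite ltn_pmul2r // expn_gt0; lia.
by lia.
Qed.

Definition state B C L : Prop :=
  [/\ base M B, C \subset E, gconnected M B C & sticks M B C L].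

(** The stick to prolong is the first one without neighbours in [C1]. It comes no later than [s], so
    the ports in [D] still belong to later sticks. *)
Lemma state_advance B B' C C1 D L1 s L2 : state B C (L1 ++ s :: L2) -> base M B' ->
  C1 \subset C -> C1 != set0 -> gconnected M B' C1 ->
  (forall x, x \in D -> exists2 s', s' \in L2 & x = s'.1) ->
  B' :\: (C :|: D) = B :\: (C :|: D) ->
  (forall c, c \in C1 -> ~~ fadj M B' s.1 c) -> size (L1 ++ s :: L2) < beta ->
  exists L', [/\ state B' C1 L', size L' < beta & potential (L1 ++ s :: L2) < potential L'].
Proof.
move=> st bB' sC1 nC1 con1 hD eBD nadj szL.
pose adj1 u := [exists c in C1, fadj M B' u.1 c].
have [L1' [s1 [L2' [eL all1 ns1 hD']]]] : exists L1' s1 L2', [/\ L1 ++ s :: L2 = L1' ++ s1 :: L2',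
    all adj1 L1', ~~ adj1 s1 & forall x, x \in D -> exists2 s', s' \in L2' & x = s'.1].
  case: (boolP (all adj1 L1)) => [all1|/first_split[L3 [s1 [L4 [eL all1 ns1]]]]].
    exists L1, s, L2; split=> //; apply/existsP => -[c /andP[cC1]].
    by apply/negP/nadj.
  exists L3, s1, (L4 ++ s :: L2); rewrite eL -catA; split=> // x /hD[s' s'L ->].
  by exists s' => //; rewrite mem_cat inE s'L !orbT.
rewrite {}eL in st szL *; case: st => bB sCE conC stL.
have [||s' [ss' stL']] := advance bB bB' sCE sC1 nC1 conC stL hD' eBD.
- by move=> u uL; have /existsP[c /andP[cC1 a]] := allP all1 u uL; exists c.
- move=> c cC1; apply: contra ns1 => a; by apply/existsP; exists c; rewrite cC1.
exists ([seq u <- L1' | size s1.2 < size u.2] ++ [:: s']); split.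
- by split=> //; apply: subset_trans sC1 sCE.
- rewrite size_cat size_filter; apply: leq_ltn_trans szL.
  by have := count_size (fun u => size s1.2 < size u.2) L1'; rewrite size_cat /=; lia.
by apply: potential_advance => //; case: stL.
Qed.

Lemma ports_uniq B L : pairwise (before M B) L -> uniq [seq s.1 | s <- L].
Proof.
rewrite uniq_pairwise pairwise_map; apply: sub_pairwise => s s' /andP[+ _].
by rewrite inE negb_or eq_sym => /andP[].
Qed.

Variable K : nat.

(** A round costs at most three levels of depth, two for splitting [C] and one for passing to a
    component, and at most [w] in connectivity. With fewer than [beta.-1] sticks an element of [C]
    is removed; with [beta.-1] of them [C] is split. *)
Lemma step B C L d : bdec M w E -> state B C L -> ~ dec M K d.+3 C ->
  lambda M C + w + 2 <= K -> size L < beta ->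
  exists B' C' L', [/\ state B' C' L', ~ dec M K d C', lambda M C' <= lambda M C + w,
    size L' < beta & potential L < potential L'].
Proof.
move=> bE st nC lC szL; have K0 : 0 < K by lia.
have [bB sCE conC [okL befL lonL]] := st.
have big_sub B' (Y : {set T}) c : base M B' -> Y \subset C -> lambda M Y <= lambda M C + w -> ~ dec M K d.+1 Y ->
    exists2 C1 : {set T}, [/\ C1 \subset Y :\ c, C1 != set0 & gconnected M B' C1] &
    ~ dec M K d C1 /\ forall x, x \in C1 -> C1 = component M B' (Y :\ c) x.
  move=> bB' sY lY nY; have sYE := subset_trans sY sCE.
  have [|x xY nx] := big_component K0 c bB' sYE _ nY; first by lia.
  exists (component M B' (Y :\ c) x); split=> //.
  - exact: component_sub.
  - by apply/set0Pn; exists x; rewrite inE xY connect0.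
  - exact: component_connected.
  move=> y; rewrite inE => /andP[_ xy]; apply/setP => z; rewrite !inE.
  by rewrite (same_connect (@within_sym _ _ _ _) xy).
have lcomp B' (Y : {set T}) c (C1 : {set T}) : base M B' -> Y \subset E -> C1 != set0 ->
    (forall x, x \in C1 -> C1 = component M B' (Y :\ c) x) -> lambda M C1 <= lambda M (Y :\ c).
  move=> bB' sY /set0Pn[x xC1] /(_ x xC1) eC1.
  have sYE : Y :\ c \subset E by apply: subset_trans (subsetDl _ _) sY.
  by rewrite eC1; apply: lambda_separated bB' sYE (component_sub _ _ _ _) (@component_separated _ _ _ _ _).
case: (ltnP (size L).+1 beta) => [szL1|szL2].
  have [c cC] : exists c, c \in C.
    by apply/set0Pn/eqP => C0; apply: nC; apply: dec_small; rewrite // C0 cards0.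
  have nC1 : ~ dec M K d.+1 C.
    by move=> h; apply: nC; do 2 (apply: decS => //; first by lia).
  have [C1 [sC1 nC10 con1] [nd1 eC1]] := big_sub B C c bB (subxx _) (leq_addr _ _) nC1.
  have lC1 : lambda M C1 <= lambda M C + w.
    apply: leq_trans (lcomp B C c C1 bB sCE nC10 eC1) _.
    apply: leq_trans (lambdaD_le _ sCE) _; rewrite leq_add2l.
    by apply: leq_trans (lambda_card _ _) _; rewrite cards1.
  have sC1C : C1 \subset C by apply: subset_trans sC1 (subsetDl _ _).
  case: (boolP (all (fun u => [exists c in C1, fadj M B u.1 c]) L)) => [/allP allL|].
    (* Every stick keeps a neighbour in [C1], so [c] is appended as a stick consisting of a port
       only, of weight 1. It has a neighbour in [C1] because [C] is connected. *)
    exists B, C1, (L ++ [:: (c, [::])]); split=> //.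
    + split=> //; first exact: subset_trans sC1C sCE.
      split.
      * move=> u; rewrite mem_cat inE => /orP[uL|/eqP->].
          have [h1 h2 h3 h4] := okL u uL; split=> //.
          - by move=> x /h2/andP[-> xC] /=; apply: contra xC; apply: (subsetP sC1C).
          - by have /existsP[c' /andP[]] := allL u uL; exists c'.
          by move=> x c' xu /(subsetP sC1C); apply: h4.
        split=> //.
        - move=> x; rewrite inE => /eqP->; rewrite (subsetP sCE) //=.
          by apply/negP => /(subsetP sC1); rewrite !inE eqxx.
        have /set0Pn[x xC1] := nC10; apply: contrapT => no.
        have ne : C1 = C; last first.
          have cC1 : c \in C1 by rewrite ne.
          by have := subsetP sC1 c cC1; rewrite !inE eqxx.
        have := subsetP sC1 x xC1 => xC1'.
        apply: (gconnected_separated conC xC1 sC1C) => y v yC1 /setDP[vC vC1].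
        case: (eqVneq v c) => [->|vc].
          by rewrite fadj_sym; apply/negP => a; apply: no; exists y.
        have := @component_separated _ M B (C :\ c) x; rewrite -(eC1 x xC1) => h.
        by apply: h => //; rewrite !inE vC1 vc.
      * rewrite pairwise_cat /= andbT befL andbT; apply/allrelP => u v uL; rewrite inE => /eqP->.
        have [h1 h2 h3 h4] := okL u uL; apply/andP; split.
          by apply/negP => /h2; rewrite cC andbF.
        by apply/allP => x xu; apply: h4.
      rewrite pairwise_cat /= andbT lonL andbT; apply/allrelP => u v uL; rewrite inE => /eqP->.
      by [].
    + by rewrite size_cat addn1.
    by rewrite /potential big_cat big_cons big_nil /= addn0 addn1.
  case/first_split => L1 [s [L2 [eL _ ns]]]; rewrite eL in st szL *.
  have [||L' [h1 h2 h3]] := @state_advance B B C C1 set0 L1 s L2 st bB sC1C nC10 con1 _ erefl _ szL.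
  - by move=> x; rewrite inE.
  - by move=> c' c'C1; apply: contra ns => a; apply/existsP; exists c'; rewrite c'C1.
  by exists B, C1, L'.
have lC2 : lambda M C + w <= K by lia.
have [X [sXE lX nX1 nX2]] := split_large K0 sCE lC2 bE nC.
pose P := [seq s.1 | s <- L].
have PE x : x \in P -> (x \in E) && (x \notin C).
  by case/mapP => s /okL[_ h _ _] ->; apply: h; apply: mem_head.
have sP (Q : {set T}) : Q \subset [set x in P] -> Q \subset E /\ [disjoint Q & C].
  move=> sQ; split; first by apply/subsetP => x /(subsetP sQ); rewrite inE => /PE/andP[].
  by apply/pred0P => x /=; apply/negP => /andP[/(subsetP sQ)]; rewrite inE => /PE/andP[_ /negP].
pose Qin := [set x in P] :&: B; pose Qout := [set x in P] :\: B.
have [S [Y [sSP nS hY hS]]] : exists S Y : {set T},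
    [/\ S \subset [set x in P], S != set0, Y = C :&: X \/ Y = C :\: X &
    forall p, p \in S ->
    exists B', [/\ base M B', B' :\: (C :|: S :\ p) = B :\: (C :|: S :\ p) &
      forall y, y \in Y -> ~~ fadj M B' p y]].
  have cP : #|[set x in P]| = size L.
    rewrite cardsE -(size_map fst L); apply/card_uniqP; exact: ports_uniq befL.
  case: (ltnP (lambda M X) #|Qin|) => [lt|ge].
    have [_ dQ] := sP Qin (subsetIl _ _).
    have [S [Y [h1 h2 h3 h4]]] := dependent_ports_in bB (subsetIr _ _) dQ sCE sXE lt.
    by exists S, Y; split=> //; apply: subset_trans h1 (subsetIl _ _).
  (* There are [2 * w - 1] distinct ports, and at most [lambda M X < w] of them lie in [B]; so at
     least [w] lie outside. *)
  have lt : lambda M X < #|Qout|.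
    by have := cardsID B [set x in P]; rewrite cP -/Qin -/Qout; lia.
  have [sQ dQ] := sP Qout (subsetDl _ _).
  have dQB : [disjoint Qout & B] by rewrite -setI_eq0; apply/eqP/setP => z; rewrite !inE; case: (z \in B); rewrite ?andbF.
  have [S [Y [h1 h2 h3 h4]]] := dependent_ports_out bB dQB dQ sQ sCE lt.
  by exists S, Y; split=> //; apply: subset_trans h1 (subsetDl _ _).
(* For the first stick with port in [S], all other ports in [S] belong to [L2], as [state_advance]
   demands of the elements of [D]. *)
have [L1 [s [L2 [eL nSL1 sS]]]] : exists L1 s L2, [/\ L = L1 ++ s :: L2,
    all (fun u => u.1 \notin S) L1 & ~~ (s.1 \notin S)].
  apply: first_split; have /set0Pn[x xS] := nS.
  have := subsetP sSP x xS; rewrite inE => /mapP[s sL xs].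
  by apply/allPn; exists s => //; rewrite -xs xS.
rewrite negbK in sS.
have [B' [bB' eB' nB']] := hS _ sS.
have sYC : Y \subset C by case: hY => ->; rewrite ?subsetIl ?subsetDl.
have lY : lambda M Y <= lambda M C + w.
  apply: (@leq_trans (lambda M C + lambda M X)); last by rewrite leq_add2l ltnW.
  by case: hY => ->; [apply: lambdaI_le | apply: lambdaD_le].
have nY : ~ dec M K d.+1 Y by case: hY => ->.
have sE' : s.1 \notin Y.
  have : s.1 \in P by rewrite /P eL map_f // mem_cat inE eqxx orbT.
  by case/PE/andP => _; apply: contra; apply: (subsetP sYC).
(* Removing [s.1], which is not in [Y], makes [big_sub] return a deep component of [Y] itself. *)
have eY : Y :\ s.1 = Y by apply/setP => z; rewrite !inE; case: eqP => // ->; rewrite (negPf sE').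
have [C1 [sC1 nC10 con1] [nd1 eC1]] := big_sub B' Y s.1 bB' sYC lY nY.
have lC1 : lambda M C1 <= lambda M C + w.
  by apply: leq_trans (lcomp B' Y s.1 C1 bB' (subset_trans sYC sCE) nC10 eC1) _; rewrite eY.
rewrite eY in sC1.
have hD x : x \in S :\ s.1 -> exists2 s', s' \in L2 & x = s'.1.
  rewrite !inE => /andP[xs xS]; have := subsetP sSP x xS; rewrite inE => /mapP[s' + xs'].
  rewrite eL mem_cat inE => /or3P[s'L1|/eqP es|]; last by exists s'.
    by have := allP nSL1 s' s'L1; rewrite -xs' xS.
  by rewrite xs' es eqxx in xs.
rewrite eL in st szL *.
have [|L' [h1 h2 h3]] := @state_advance B B' C C1 _ L1 s L2 st bB' (subset_trans sC1 sYC) nC10 con1 hD eB' _ szL.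
  by move=> c /(subsetP sC1)/nB'.
by exists B', C1, L'.
Qed.

Lemma potential_lt k L : size L < beta -> all (fun u => size u.2 <= k) L ->
  potential L < beta ^ k.+1.
Proof.
move=> szL small; apply: (@leq_ltn_trans (size L * beta ^ k)); last first.
  by rewrite expnS ltn_pmul2r // expn_gt0; lia.
rewrite /potential; elim: L small {szL} => [|u L IH] /=; rewrite ?big_nil // big_cons (mulSn (size L)).
by case/andP => us /IH le; rewrite leq_add // leq_pexp2l //; lia.
Qed.

(** [N] bounds the rounds still to come: each raises the potential by at least one, and as long as
    all sticks have length at most [k] it stays below [beta ^ k.+1]. *)
Lemma run k N B C L : bdec M w E -> state B C L -> ~ dec M K (3 * N) C ->
  lambda M C + w * N + 2 <= K -> size L < beta -> beta ^ k.+1 <= potential L + N ->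
  exists B s, [/\ base M B, ipath (fadj M B) (s.1 :: s.2) & k < size s.2].
Proof.
move=> bE; elim: N B C L => [|N IHN] B C L st nC lC szL pot.
  case: (boolP (all (fun u => size u.2 <= k) L)) => [small|].
    by have := potential_lt szL small; rewrite ltnNge; rewrite addn0 in pot; rewrite pot.
  case/allPn => s sL; rewrite -ltnNge => ks.
  by have [bB _ _ [okL _ _]] := st; have [h _ _ _] := okL s sL; exists B, s.
case: (boolP (all (fun u => size u.2 <= k) L)) => [small|]; last first.
  case/allPn => s sL; rewrite -ltnNge => ks.
  by have [bB _ _ [okL _ _]] := st; have [h _ _ _] := okL s sL; exists B, s.
rewrite mulnS in nC; rewrite mulnS in lC.
have [|B' [C' [L' [st' nC' lC' szL' pot']]]] := step bE st nC _ szL; first by lia.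
by apply: (IHN B' C' L') => //; lia.
Qed.

End Steps.

(** * Branch-decompositions *)


Section Trees.
Variable G : sgraph.
Hypothesis treeG : is_tree G.
Implicit Types a b c x y z u v : G.

Lemma set2_eq (V : finType) (x y a b : V) :
  [set x; y] = [set a; b] -> (x = a /\ y = b) \/ (x = b /\ y = a).
Proof.
move=> e; have h (z : V) : (z == x) || (z == y) = (z == a) || (z == b).
  by have := congr1 (fun S : {set V} => z \in S) e; rewrite !inE.
have /orP hx : (x == a) || (x == b) by rewrite -h eqxx.
have /orP hy : (y == a) || (y == b) by rewrite -h eqxx orbT.
have /orP ha : (a == x) || (a == y) by rewrite h eqxx.
have /orP hb : (b == x) || (b == y) by rewrite h eqxx orbT.
case: hx => /eqP xa; case: hy => /eqP ya; [| by left | by right |].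
  by left; split=> //; case: hb => /eqP ->; rewrite // ya xa.
by left; split=> //; case: ha => /eqP ->; rewrite // xa ya.
Qed.

Lemma edges_adj x y : ([set x; y] \in edges G) = adj x y.
Proof.
apply/edgesP/idP => [[u [v [a /set2_eq[[-> ->]|[-> ->]]]]]|a] //; first by rewrite adj_sym.
by exists x, y.
Qed.

Lemma tree_bridge a b : adj a b -> ~~ connect (del_edge a b) a b.
Proof.
move=> ab; have [_ _ ac] := treeG.
have ac' : acyclic (@spanning_adj G (edges G)).
  by apply: acyclic_sub ac => x y; rewrite /spanning_adj /= edges_adj.
have nab : a != b by apply: contraTneq ab => ->; rewrite adj_irr.
have := acyclic_bridge ac' nab; rewrite edges_adj => /(_ ab).
rewrite (@eq_connect _ _ (del_edge a b)) // => x y.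
by rewrite /spanning_adj /= in_setD1 edges_adj andbC.
Qed.

Lemma del_node_edge a c x y : del_node a x y -> del_edge c a x y && del_edge a c x y.
Proof.
case/and3P => xa ya xy; rewrite /del_edge /= xy /=.
apply/andP; split; apply/negP => /eqP/set2_eq[[e1 e2]|[e1 e2]];
by move: xa ya; rewrite ?e1 ?e2 eqxx.
Qed.

Lemma connect_del_node_edge a c x y : connect (del_node a) x y -> connect (del_edge c a) x y.
Proof. by apply: connect_sub => u v /(del_node_edge c)/andP[h _]; apply: connect1. Qed.

Lemma del_edge_sym a b : del_edge a b =2 del_edge b a.
Proof. by move=> x y; rewrite /del_edge /= (setUC [set a]). Qed.

Lemma del_edge_csym a b : connect_sym (del_edge a b).
Proof. by apply: sym_connect_sym => x y; rewrite /del_edge /= adj_sym (setUC [set x]). Qed.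

Lemma del_node_csym a : connect_sym (del_node a).
Proof. by apply: sym_connect_sym => x y; rewrite /del_node /= adj_sym andbCA. Qed.

(** The edge between [a] and [c] is a bridge, so a walk from [c] that avoids this edge never reaches
    [a]. *)
Lemma side_avoid a c x : adj a c -> connect (del_edge c a) c x = connect (del_node a) c x.
Proof.
move=> ac; apply/idP/idP; last exact: connect_del_node_edge.
have na z : connect (del_edge c a) c z -> z != a.
  by apply: contraTneq => ->; apply: tree_bridge; rewrite adj_sym.
suff gen p z : connect (del_edge c a) c z -> path (del_edge c a) z p ->
    connect (del_node a) z (last z p).
  by case/connectP => p pth ->; apply: gen pth; apply: connect0.
elim: p z => [|y p IHp] z cz /=; first by rewrite connect0.
move=> /andP[zy pth]; have cy := connect_trans cz (connect1 zy).
apply: connect_trans (IHp y cy pth); apply: connect1.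
by apply/and3P; split; [exact: na | exact: na | case/andP: zy].
Qed.

Lemma neighbour_sides a c c' x : adj a c -> adj a c' ->
  connect (del_node a) c x -> connect (del_node a) c' x -> c = c'.
Proof.
move=> ac ac' cx c'x; apply: contraTeq (ac) => ncc'; apply/negP => _.
have : connect (del_edge c a) c a.
  apply: (@connect_trans _ _ c').
    by apply: connect_del_node_edge; apply: connect_trans cx _; rewrite del_node_csym.
  apply: connect1; rewrite /del_edge /= adj_sym ac' /=; apply/negP => /eqP/set2_eq[[e _]|[e1 e2]].
    by rewrite e eqxx in ncc'.
  by rewrite -e2 -e1 eqxx in ncc'.
by apply/negP/tree_bridge; rewrite adj_sym.
Qed.

Lemma opposite_sides a b x : adj a b -> connect (del_node b) a x -> ~~ connect (del_node a) b x.
Proof.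
move=> ab ax; apply/negP => bx; have := tree_bridge ab; apply/negP; rewrite negbK.
apply: connect_trans (connect_del_node_edge a ax) _.
rewrite del_edge_csym (eq_connect (del_edge_sym a b)).
exact: connect_del_node_edge.
Qed.

Lemma first_step a x : x != a -> exists2 c, adj a c & connect (del_node a) c x.
Proof.
move=> xa; have [_ con _] := treeG; have /connectP[p0 pth0] := con a x.
case: (shortenP pth0) => p pth unq _ lst; case: p pth unq lst => [|c p] /=.
  by move=> _ _ e; rewrite e eqxx in xa.
move=> /andP[ac pth] /andP[anp unq] lst; exists c => //; apply/connectP; exists p => //.
elim: p c pth anp {ac unq lst} => //= y p IHp c /andP[cy pth].
rewrite 2!inE 2!negb_or => /and3P[ac ay anp].
by rewrite IHp ?inE ?negb_or ?ay ?anp // andbT; apply/and3P; rewrite !(eq_sym _ a).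
Qed.

Lemma side_step a b c x : adj a b -> adj a c -> c != b ->
  connect (del_node a) c x -> connect (del_node b) a x.
Proof.
move=> ab ac cb cx; rewrite -side_avoid 1?adj_sym //.
apply: (@connect_trans _ _ c).
  apply: connect1; rewrite /del_edge /= ac /=; apply/negP => /eqP/set2_eq[[_ e]|[e _]].
    by rewrite e eqxx in cb.
  by rewrite e adj_irr in ab.
by rewrite (eq_connect (del_edge_sym a b)); apply: connect_del_node_edge.
Qed.

Lemma side_split a b x : adj a b -> x != a -> connect (del_node b) a x ->
  exists c, [/\ adj a c, c != b & connect (del_node a) c x].
Proof.
move=> ab xa bx; have [c ac cx] := first_step xa; exists c; split=> //.
apply: contraTneq bx => ?; subst c; apply: contraL cx => bx; exact: opposite_sides.
Qed.

Lemma del_node_start a c x : c != a -> connect (del_node a) c x -> x != a.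
Proof.
move=> ca; rewrite del_node_csym => /connectP[[|y p]] /=; first by move=> _ <-.
by case/andP => /and3P[].
Qed.

Variables (T : finType) (M : matroid T) (sigma : T -> G) (w : nat).
Hypothesis deg13 : forall v, degree v = 1 \/ degree v = 3.
Hypothesis leafs : leaf_bijection M sigma.
Hypothesis width : branch_decomposition_width M sigma <= w.

Definition side a b : {set T} := [set t in ground M | connect (del_node b) a (sigma t)].

Lemma side_lambda a b : adj a b -> lambda M (side a b) < w.
Proof.
move=> ab; apply: leq_trans width.
have := @leq_bigmax_cond _ (fun ab : G * G => adj ab.1 ab.2)
  (fun ab => edge_width M sigma ab.1 ab.2) (a, b) ab.
rewrite /edge_width /= -/(branch_decomposition_width M sigma); congr (_ < _).
congr lambda; apply/setP => t; rewrite !inE side_avoid // 1?adj_sym //.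
Qed.

(** Induction on the number of nodes on the side of [a]: if [a] is a leaf, it carries the only
    element there; if it has degree 3, the side splits along its two other edges. *)
Lemma side_bdec a b : adj a b -> bdec M w (side a b).
Proof.
have [injs ims] := leafs.
have [n] := ubnP #|[set x | connect (del_node b) a x]|; elim: n a b => // n IHn a b ltn ab.
have ba : b != a by apply: contraTneq ab => ->; rewrite adj_irr.
have lab := side_lambda ab.
case: (deg13 a) => deg.
  apply: bdec_leaf lab; last by apply/subsetP => t; rewrite inE => /andP[].
  have only t : t \in side a b -> sigma t = a.
    rewrite inE => /andP[_ ct]; apply/eqP/negPn/negP => ta.
    have [c [ac cb _]] := side_split ab ta ct.
    move: deg; rewrite /degree => /eqP/cards1P[z ez].
    have : c \in [set y | adj a y] by rewrite inE.
    have : b \in [set y | adj a y] by rewrite inE.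
    by rewrite ez !inE => /eqP e1 /eqP e2; rewrite e1 e2 eqxx in cb.
  have sE t : t \in side a b -> t \in ground M by rewrite inE => /andP[].
  by apply/card_le1_eqP => t t' tS t'S; apply: injs; rewrite ?sE // !only.
have c2 : #|[set y | adj a y] :\ b| = 2.
  by move: deg; rewrite /degree (cardsD1 b) inE ab add1n => -[].
have [x [y [xy exy]]] : exists x y, x != y /\ [set y | adj a y] :\ b = [set x; y].
  by have /eqP/cards2P[x [y [xy e]]] := c2; exists x, y.
have nb z : (z != b) && adj a z = (z == x) || (z == y).
  by have := congr1 (fun S : {set G} => z \in S) exy; rewrite !inE.
have /andP[xb ax] : (x != b) && adj a x by rewrite nb eqxx.
have /andP[yb ay] : (y != b) && adj a y by rewrite nb eqxx orbT.
have smaller c : c != b -> adj a c -> bdec M w (side c a).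
  move=> cb ac; apply: IHn; last by rewrite adj_sym.
  rewrite ltnS in ltn; apply: leq_trans ltn; apply: proper_card; apply/properP; split.
    by apply/subsetP => z; rewrite !inE; apply: side_step.
  have ca : c != a by apply: contraTneq ac => ->; rewrite adj_irr.
  by exists a; rewrite !inE ?connect0 //; apply/negP => /(del_node_start ca); rewrite eqxx.
have eS : side a b = side x a :|: side y a.
  apply/setP => t; rewrite !inE -andb_orr; case tE: (t \in ground M) => //=.
  have ta : sigma t != a.
    have : sigma t \in [set v | leaf v] by rewrite -ims; apply: imset_f.
    by rewrite inE /leaf; apply: contraTneq => ->; rewrite deg.
  apply/idP/orP => [/(side_split ab ta)[c [ac cb cx]]|[]]; last 2 first.
  - exact: side_step.
  - exact: side_step.
  by have := nb c; rewrite cb ac /= => /esym/orP[]/eqP <-; [left|right].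
rewrite eS; apply: bdec_node; rewrite -?eS //; try exact: smaller.
apply/pred0P => t /=; apply/negP; rewrite !inE => /andP[/andP[_ h1] /andP[_ h2]].
by move: xy; rewrite (neighbour_sides ax ay h1 h2) eqxx.
Qed.

Lemma branch_bdec : 1 < #|ground M| -> bdec M w (ground M).
Proof.
move=> /ltnW/card_gt0P[t0 t0E]; have [injs ims] := leafs.
set a := sigma t0.
have : a \in [set v | leaf v] by rewrite -ims; apply: imset_f.
rewrite inE /leaf /degree => /cards1P[b eb].
have ab : adj a b by have : b \in [set y | adj a y] by [rewrite eb set11]; rewrite inE.
have eE : ground M = side a b :|: side b a.
  apply/setP => t; rewrite !inE -andb_orr; case: (t \in ground M) => //=; apply/esym.
  case: (eqVneq (sigma t) a) => [->|ta]; first by rewrite connect0.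
  have [c ac cx] := first_step ta; case: (eqVneq c b) => [<-|cb]; first by rewrite cx orbT.
  by rewrite (side_step ab ac cb cx).
rewrite eE; apply: bdec_node; rewrite -?eE.
- exact: side_bdec.
- by apply: side_bdec; rewrite adj_sym.
- apply/pred0P => t /=; apply/negP; rewrite !inE => /andP[/andP[_ h1] /andP[_ h2]].
  by have := opposite_sides ab h1; rewrite h2.
by rewrite lambda_ground; apply: leq_ltn_trans (side_lambda ab).
Qed.

End Trees.

(** * Trees from nested partitions *)


Lemma dist_le (G : sgraph) (x : G) p : path (@adj G) x p -> dist x (last x p) <= size p.
Proof.
move=> pth; rewrite /dist; set P := (P in least P).
have [|_] := @leastP P; first by exists (size p), p.
by apply; exists p.
Qed.

Lemma radius_le (G : sgraph) (x : G) r : (forall y, dist x y <= r) -> radius G <= r.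
Proof.
move=> h; rewrite /radius; set P := (P in least P).
by have [|_] := @leastP P; [exists r, x | apply; exists x].
Qed.

Section Addresses.
Variables (T : finType) (M : matroid T) (K : nat) (t0 : T).
Implicit Types (Y A : {set T}) (F : T -> seq T) (u : seq T).
Local Notation E := (ground M).

(* F x lists the labels of the parts containing x, from the top partition down. *)
Definition address d Y F : Prop :=
  [/\ forall x, size (F x) = d,
      forall u A, size u < d ->
        lambda M [set x in Y | (take (size u) (F x) == u) && (nth t0 (F x) (size u) \in A)] <= K &
      {in Y &, injective F}].

Lemma address_cons d Y (f : T -> T) (F : T -> T -> seq T) :
  (forall A, lambda M [set x in Y | f x \in A] <= K) ->
  (forall a, address d [set x in Y | f x == a] (F a)) ->
  address d.+1 Y (fun x => f x :: F (f x) x).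
Proof.
move=> hf hF; split=> [x|[|a u] A|x y xY yY [fxy]].
- by have [h _ _] := hF (f x); rewrite /= h.
- by move=> _; apply: hf.
- rewrite /= ltnS => lt; have [_ h _] := hF a; apply: leq_trans (h u A lt).
  rewrite leq_eqVlt; apply/orP; left; apply/eqP; congr lambda.
  apply/setP => x; rewrite !inE eqseq_cons -andbA -!andbA; case: (eqVneq (f x) a) => [->|_] //=.
have [_ _ h] := hF (f x); rewrite -fxy => /h; apply; by rewrite inE ?xY ?yY ?fxy eqxx.
Qed.

Lemma dec_address d Y : dec M K d Y -> exists F, address d Y F.
Proof.
elim: d Y => [|d IHd] Y /=.
  move=> /card_le1_eqP Y1; exists (fun=> [::]); split=> // x y xY yY _; exact: Y1.
case=> f [hf hd]; have [F hF] := choice (fun a => IHd _ (hd a)).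
by exists (fun x => f x :: F (f x) x); apply: address_cons.
Qed.

End Addresses.

(** * The tree of prefixes of addresses *)

Section DecTree.
Variables (T : finType) (M : matroid T) (K d : nat) (t0 : T) (F : T -> seq T).
Local Notation E := (ground M).
Hypothesis addrF : address M K t0 d E F.
Hypothesis d0 : 0 < d.
Hypothesis t0E : t0 \in E.
Hypothesis branching : exists2 t, t \in E & take 1 (F t) != take 1 (F t0).

Definition prefixes : seq (seq T) := [seq take j (F x) | x <- enum E, j <- iota 0 d.+1].

Definition vtx : finType := seq_sub prefixes.
Implicit Types (u v x y : vtx) (t s : T).

Lemma sizeF t : size (F t) = d. Proof. by have [h _ _] := addrF. Qed.

Lemma mem_prefixes t j : t \in E -> take j (F t) \in prefixes.
Proof.
move=> tE; apply/allpairsP; case: (leqP j d) => jd.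
  by exists (t, j); split; [rewrite mem_enum | rewrite mem_iota | ].
exists (t, d); split; [by rewrite mem_enum | by rewrite mem_iota add0n ltnS leqnn | ].
by rewrite /= !take_oversize ?sizeF // ltnW.
Qed.

Definition root0 : vtx := SeqSub (mem_prefixes 0 t0E).
(** For [t] in the ground set the default [root0] is never taken, since all prefixes of its address
    are vertices. *)
Definition vx t j : vtx := insubd root0 (take j (F t)).

Lemma vxE t j : t \in E -> val (vx t j) = take j (F t).
Proof. by move=> tE; rewrite val_insubd mem_prefixes. Qed.

Lemma size_vx t j : t \in E -> j <= d -> size (val (vx t j)) = j.
Proof. by move=> tE jd; rewrite vxE // size_takel ?sizeF. Qed.

Lemma vtxP v : exists t, [/\ t \in E, v = vx t (size (val v)) & size (val v) <= d].
Proof.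
have /allpairsP[[t j] [tE jd ev]] := ssvalP v.
rewrite mem_enum /= in tE; rewrite mem_iota add0n ltnS /= in jd.
have sv : size (val v) = j by rewrite [val v]ev size_takel ?sizeF.
by exists t; split; rewrite ?sv //; apply: val_inj; rewrite vxE.
Qed.

Definition child : rel vtx :=
  [rel u v | (size (val v) == (size (val u)).+1) && (take (size (val u)) (val v) == val u)].
Definition vadj : rel vtx := [rel u v | child u v || child v u].

Lemma vadj_sym : symmetric vadj. Proof. by move=> u v; rewrite /vadj /= orbC. Qed.
Lemma vadj_irr : irreflexive vadj.
Proof. by move=> u; rewrite /vadj /child /= orbb; apply/negP => /andP[/eqP]; lia. Qed.

Definition dtree : sgraph := SGraph vadj_sym vadj_irr.

Lemma child_vx t j : t \in E -> j < d -> child (vx t j) (vx t j.+1).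
Proof.
move=> tE jd; rewrite /child /= !vxE // !size_takel ?sizeF // 1?ltnW // eqxx /=.
by rewrite take_takel.
Qed.

Lemma parent_uniq u u' v : child u v -> child u' v -> u = u'.
Proof.
move=> /andP[/eqP s1 /eqP e1] /andP[/eqP s2 /eqP e2]; apply: val_inj.
by rewrite -e1 -e2; congr (take _ _); move: s2; rewrite s1 => -[].
Qed.

Lemma path_root t j : t \in E -> j <= d ->
  exists p, [/\ path vadj root0 p, last root0 p = vx t j & size p = j].
Proof.
move=> tE; elim: j => [|j IHj] jd.
  by exists [::]; split=> //=; apply: val_inj; rewrite vxE //= !take0.
have [p [pth lst sz]] := IHj (ltnW jd).
exists (rcons p (vx t j.+1)); rewrite rcons_path pth last_rcons size_rcons sz lst; split=> //=.
by rewrite /vadj /= child_vx.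
Qed.

Lemma dtree_tree : is_tree dtree.
Proof.
have con x : connect vadj root0 x.
  have [t [tE ex sz]] := vtxP x; have [p [pth lst _]] := path_root tE sz.
  by apply/connectP; exists p => //; rewrite lst.
split; first by apply/card_gt0P; exists root0.
  move=> x y; apply: connect_trans (con y).
  by rewrite (sym_connect_sym vadj_sym).
move=> c /andP[cyc unq]; rewrite leqNgt; apply/negP => gt2.
have [v0 v0c] : exists v0, v0 \in c by case: c gt2 {cyc unq} => // v0 c _; exists v0; apply: mem_head.
(* On a cycle, both neighbours of a vertex with longest prefix would be its parent, although they
   are distinct. *)
case: (@arg_maxnP vtx v0 (mem c) (fun v => size (val v)) v0c) => u uc maxu.
have up v : v \in c -> vadj u v -> child v u.
  move=> vc /orP[/andP[/eqP sv _]|//].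
  by have : size (val v) <= size (val u) := maxu v vc; rewrite sv ltnn.
have [i p def_c] := rot_to uc.
have sub v : v \in u :: p -> v \in c by rewrite -def_c mem_rot.
rewrite -(size_rot i) def_c in gt2; rewrite -(rot_cycle i) def_c in cyc.
rewrite -(rot_uniq i) def_c in unq.
case: p {def_c} gt2 cyc unq sub => [|v [|z q]] // _ cyc unq sub.
have uv : vadj u v by case/andP: cyc.
have lu : vadj (last z q) u by move: cyc; rewrite /= rcons_path => /and3P[_ _ /andP[]].
have zq : last z q \in z :: q by apply: mem_last.
have e : v = last z q.
  apply: (@parent_uniq _ _ u); first by apply: up uv; apply: sub; rewrite !inE eqxx orbT.
  by apply: up; [apply: sub; rewrite (in_cons u) (in_cons v) zq !orbT | rewrite vadj_sym].
by case/and3P: unq => _ /negP[]; rewrite {1}e.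
Qed.

(** A prefix of length strictly between 0 and [d] has a parent and a child, the root has two
    children by [branching], and a prefix of length [d] has only its parent. *)
Lemma vtx_leaf v : leaf (v : dtree) = (size (val v) == d).
Proof.
have [t [tE ev sz]] := vtxP v; apply/idP/eqP => [|sd].
  move=> /cards1P[z ez]; apply/eqP; rewrite eqn_leq sz leqNgt; apply/negP => lt.
  have uniq_nb x y : vadj v x -> vadj v y -> x = y.
    have h (y' : dtree) : vadj v y' -> y' = z by move=> a; apply/set1P; rewrite -ez inE.
    by move=> /h-> /h->.
  have cv : vadj v (vx t (size (val v)).+1) by rewrite /vadj /= {1}ev child_vx.
  case: (posnP (size (val v))) => [s0|s0].
    have [t' t'E nt] := branching.
    have vr s : s \in E -> vadj v (vx s 1).
      move=> sE; suff -> : v = vx s 0 by rewrite /vadj /= child_vx.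
      by apply: val_inj; rewrite vxE // take0; apply: size0nil.
    have := uniq_nb _ _ (vr _ t'E) (vr _ t0E) => /(congr1 val); rewrite !vxE // => e.
    by rewrite e eqxx in nt.
  have pv : vadj v (vx t (size (val v)).-1).
    apply/orP; right; have := @child_vx t (size (val v)).-1 tE.
    by rewrite prednK // -ev; apply; apply: ltnW.
  have := uniq_nb _ _ cv pv => /(congr1 (fun u : vtx => size (val u))).
  by rewrite !size_vx // ?(leq_trans (leq_pred _)) //; move: s0; clear; lia.
rewrite /leaf /degree; apply/cards1P; exists (vx t d.-1); apply/setP => y; rewrite !inE /=.
have cv : child (vx t d.-1) v.
  have e : v = vx t d by rewrite -sd.
  by have := @child_vx t d.-1 tE; rewrite prednK // e; apply.
apply/idP/eqP => [/orP[/andP[/eqP sy _]|cy]|->]; last by rewrite /vadj /= cv orbT.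
  by have [_ [_ _]] := vtxP y; rewrite sy sd ltnn.
exact: parent_uniq cy cv.
Qed.

Definition dsigma t : dtree := vx t d.

Lemma dsigma_leafs : leaf_bijection M dsigma.
Proof.
have full t : t \in E -> val (dsigma t : vtx) = F t by move=> tE; rewrite vxE // take_oversize ?sizeF.
split=> [t t' tE t'E /(congr1 val)|]; first by rewrite !full //; have [_ _ h] := addrF; apply: h.
apply/setP => v; rewrite inE vtx_leaf; apply/imsetP/eqP => [[t tE ->]|sd].
  by rewrite full // sizeF.
by have [t [tE ev _]] := vtxP v; exists t; rewrite // ev sd.
Qed.

Lemma connect_prefix (v : dtree) t i j : t \in E -> i <= j <= d ->
  (forall l, i <= l <= j -> vx t l != v) ->
  connect (@del_node dtree v) (vx t i) (vx t j).
Proof.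
move=> tE; elim: j => [|j IHj] /andP[ij jd] nv; first by move: ij; rewrite leqn0 => /eqP->; apply: connect0.
move: ij; rewrite leq_eqVlt => /orP[/eqP->|ij]; first exact: connect0.
apply: (connect_trans (IHj _ _)); first by rewrite -ltnS ij ltnW.
  by move=> l /andP[il lj]; apply: nv; rewrite il leqW.
apply: connect1; apply/and3P; split.
- by apply: nv; rewrite leqnSn andbT -ltnS.
- by apply: nv; rewrite leqnn andbT ltnW.
by rewrite /= /vadj /= child_vx.
Qed.

(** Deleting [v] leaves a component for each child and, unless [v] is the root, one through the
    parent. If a union of parts includes the latter, it is replaced by its complement; what remains
    is a union of parts below [v], bounded by [address]. *)
Lemma dtree_width (v : dtree) : ~~ leaf v -> node_width M dsigma v <= K.
Proof.
rewrite vtx_leaf => nl; have [tv [tvE ev szv]] := vtxP v.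
set n := size (val v) in nl ev szv; have {nl} nd : n < d by rewrite ltn_neqAle nl.
apply/bigmax_leqP => P sP; set U := cover P.
have sUE : U \subset E.
  apply/bigcupsP => X XP; have /imsetP[x _ ->] := subsetP sP X XP.
  by apply/subsetP => t; rewrite inE => /andP[].
have closedU t t' : t \in U -> t' \in E -> connect (@del_node dtree v) (dsigma t) (dsigma t') -> t' \in U.
  move=> /bigcupP[X XP tX] t'E tt'; apply/bigcupP; exists X => //.
  have /imsetP[x _ eX] := subsetP sP X XP; move: tX; rewrite eX !inE t'E => /andP[_ xt].
  exact: connect_trans xt tt'.
have csym : connect_sym (@del_node dtree v) := @del_node_csym dtree v.
pose inside t := take n (F t) == val v; pose lab t := nth t0 (F t) n.
have out t t' : t \in E -> t' \in E -> ~~ inside t -> ~~ inside t' ->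
    connect (@del_node dtree v) (dsigma t) (dsigma t').
  have toroot s : s \in E -> ~~ inside s -> connect (@del_node dtree v) (vx s 0) (dsigma s).
    move=> sE ns; apply: connect_prefix => //; first by rewrite leqnn.
    move=> l /andP[_ ld]; apply: contra ns => /eqP e.
    have := congr1 val e; rewrite vxE // /inside => <-.
    have : n = size (val (vx s l)) by rewrite e.
    by rewrite vxE // size_takel ?sizeF // => ->.
  move=> tE t'E nt nt'; apply: (connect_trans _ (toroot t' t'E nt')).
  rewrite csym; have -> : vx t' 0 = vx t 0 by apply: val_inj; rewrite !vxE // !take0.
  exact: toroot.
have inn t t' : t \in E -> t' \in E -> inside t -> inside t' -> lab t = lab t' ->
    connect (@del_node dtree v) (dsigma t) (dsigma t').
  have tochild s : s \in E -> connect (@del_node dtree v) (vx s n.+1) (dsigma s).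
    move=> sE; apply: connect_prefix => // [|l /andP[nl ld]]; first by rewrite nd leqnn.
    apply/negP => /eqP/(congr1 (size \o val)); rewrite /= vxE // size_takel ?sizeF // => e.
    by rewrite e ltnn in nl.
  move=> tE t'E /eqP it /eqP it' lt; apply: (connect_trans _ (tochild t' t'E)).
  rewrite csym; have -> : vx t' n.+1 = vx t n.+1; last exact: tochild.
  apply: val_inj; rewrite !vxE // !(take_nth t0) ?sizeF // it it'.
  by rewrite -/(lab t') -lt.
have [_ narrow _] := addrF.
have wide (A : {set T}) : lambda M [set t in E | inside t && (lab t \in A)] <= K by exact: (narrow (val v) A nd).
case: (pselect (exists2 t, t \in U & ~~ inside t)) => [[t tU nt]|none].
  have tE := subsetP sUE t tU.
  rewrite -(lambda_compl sUE) (_ : E :\: U = [set s in E | inside s && (lab s \in [set lab s | s in E :\: U])]) //.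
  apply/setP => s; rewrite !inE; case sE: (s \in E); rewrite ?andbF //= andbT.
  apply/idP/andP => [sU|[si /imsetP[s' + ls]]].
    split; last by apply: imset_f; rewrite inE sU sE.
    apply: contraR sU => ns; exact: (closedU _ _ tU sE (out _ _ tE sE nt ns)).
  rewrite inE => /andP[ns'U s'E]; have si' : inside s'.
    by apply: contraR ns'U => ns'; exact: (closedU _ _ tU s'E (out _ _ tE s'E nt ns')).
  by apply: contra ns'U => sU; apply: (closedU _ _ sU s'E); apply: inn.
have insU t : t \in U -> inside t by move=> tU; apply: contrapT => /negP nt; apply: none; exists t.
rewrite (_ : U = [set s in E | inside s && (lab s \in [set lab s | s in U])]) //.
apply/setP => s; rewrite !inE; apply/idP/and3P => [sU|[sE si /imsetP[s' s'U ls]]].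
  by split; [exact: (subsetP sUE) | exact: insU | apply: imset_f].
by apply: (closedU _ _ s'U sE); apply: inn => //; [exact: (subsetP sUE) | exact: insU].
Qed.

Lemma dtree_decomposition : has_decomposition M K d.
Proof.
exists dtree, dsigma; split.
- split; [exact: dtree_tree | | exact: dsigma_leafs].
  exists root0; rewrite vtx_leaf /= take0 /=; by rewrite eq_sym -lt0n.
- by apply/bigmax_leqP => v; apply: dtree_width.
apply: (@radius_le _ (root0 : dtree)) => y; have [t [tE ey sz]] := vtxP y.
have [p [pth lst sp]] := path_root tE sz.
by apply: leq_trans sz; have := @dist_le dtree _ _ pth; rewrite lst -ey sp.
Qed.

End DecTree.

(** At the least possible height the top partition has at least two parts, since a single part would
    be the whole ground set with a smaller height. This gives the branching at the root. *)
Lemma dec_decomposition (T : finType) (M : matroid T) K d :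
  0 < K -> 1 < #|ground M| -> dec M K d (ground M) -> exists2 e, e <= d & has_decomposition M K e.
Proof.
move=> K0 M1; elim: d => [|d IHd] decd; first by move: decd; rewrite /= leqNgt M1.
case: (pselect (dec M K d (ground M))) => [/IHd[e ed h]|nd]; first by exists e; rewrite // leqW.
have [t0 t0E] : exists t, t \in ground M by apply/card_gt0P/ltnW.
case: decd => f [hf hd]; have [F hF] := choice (fun a => dec_address t0 (hd a)).
exists d.+1 => //; apply: (dtree_decomposition (address_cons hf hF) _ t0E) => //.
apply: contrapT => no; apply: nd; suff -> : ground M = [set x in ground M | f x == f t0] by apply: hd.
apply/setP => x; rewrite inE; case xE: (x \in ground M) => //=; apply/esym/negPn/negP => ne.
by apply: no; exists x; rewrite //= !take0 eqseq_cons andbT.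
Qed.

(** * Fans *)


Section FanSets.
Variable T : finType.
Implicit Types (a : nat -> T) (b : pred nat).

Definition shift2 (V : Type) (a : nat -> V) : nat -> V := fun j => a j.+2.

Definition ielems m a b : {set T} := [set x | [exists j : 'I_(2 * m).+1, b j && (x == a j)]].

Lemma ielemsP m a b x :
  reflect (exists j, [/\ j <= 2 * m, b j & x = a j]) (x \in ielems m a b).
Proof.
rewrite inE; apply: (iffP existsP) => [[j /andP[bj /eqP->]]|[j [jm bj ->]]].
  by exists j; rewrite -ltnS.
by exists (Ordinal (jm : j < (2 * m).+1)); rewrite /= bj eqxx.
Qed.

Lemma ielems_sub m a b b' : subpred b b' -> ielems m a b \subset ielems m a b'.
Proof. by move=> s; apply/subsetP => x /ielemsP[j [jm /s bj ->]]; apply/ielemsP; exists j. Qed.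

Lemma ielemsS m a b : ielems m.+1 a b =
  (if b 0 then [set a 0] else set0) :|: (if b 1 then [set a 1] else set0) :|: ielems m (shift2 a) (shift2 b).
Proof.
have sel (c : bool) (x y : T) : (x \in if c then [set y] else set0) = c && (x == y).
  by case: c; rewrite !inE.
apply/setP => x; rewrite !in_setU !sel; apply/ielemsP/idP.
  case=> [[|[|j]] [jm bj ->]]; rewrite ?bj ?eqxx ?orbT //.
  by apply/orP; right; apply/ielemsP; exists j; split=> //; lia.
case/orP => [/orP[]/andP[bj /eqP->]|/ielemsP[j [jm bj ->]]].
- by exists 0.
- by exists 1; split=> //; lia.
by exists j.+2; split=> //; lia.
Qed.

Lemma ielems_add0 m a b : a 0 |: ielems m a b = ielems m a (fun j => (j == 0) || b j).
Proof.
apply/setP => x; rewrite in_setU1; apply/orP/ielemsP => [[/eqP->|/ielemsP[j [jm bj ->]]]|[j [jm]]].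
- by exists 0.
- by exists j; rewrite bj orbT.
case/orP => [/eqP->|bj] ->; first by left.
by right; apply/ielemsP; exists j.
Qed.

Variable N : matroid T.
Local Notation r := (rank N).

(* a 0, a 2, ... are the spokes, a 1, a 3, ... the rim elements. *)
Record fanlike m a : Prop := Fanlike {
  fan_inj : forall i j, i <= 2 * m -> j <= 2 * m -> a i = a j -> i = j;
  fan_spokes : indep N (ielems m a (fun j => ~~ odd j));
  fan_left : forall i, i < m -> indep N [set a (2 * i); a (2 * i).+1];
  fan_right : forall i, i < m -> indep N [set a (2 * i).+1; a (2 * i).+2];
  fan_triangle : forall i, i < m -> ~~ indep N [set a (2 * i); a (2 * i).+1; a (2 * i).+2] }.

Lemma fanlikeS m a : fanlike m.+1 a -> fanlike m (shift2 a).
Proof.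
case=> inj sp le ri tr; split.
- move=> i j im jm /inj; rewrite /shift2; lia.
- apply: indepS sp; apply/subsetP => x /ielemsP[j [jm bj ->]]; apply/ielemsP.
  by exists j.+2; rewrite /= negbK; split=> //; lia.
- by move=> i im; have := le i.+1 im; rewrite mulnS.
- by move=> i im; have := ri i.+1 im; rewrite mulnS.
by move=> i im; have := tr i.+1 im; rewrite mulnS.
Qed.

Lemma rank_same_span (X P L : {set T}) : P \subset L -> r P = r L -> r (X :|: P) = r (X :|: L).
Proof.
move=> sPL rPL; apply/eqP; rewrite eqn_leq rankS ?setUS //=.
have := rank_submod N (X :|: P) L; rewrite -setUA (setUidPr sPL).
have : r P <= r ((X :|: P) :&: L) by apply: rankS; rewrite subsetI subsetUr.
by rewrite rPL; lia.
Qed.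

Lemma rank_free_sub x (X Y : {set T}) : X \subset Y -> r (x |: Y) = (r Y).+1 -> r (x |: X) = (r X).+1.
Proof.
move=> sXY rY; have := rank_submod N (x |: X) Y; rewrite -setUA (setUidPr sXY).
have : r X <= r ((x |: X) :&: Y) by apply: rankS; rewrite subsetI subsetUr.
have := rankU_card N X [set x]; rewrite cards1 setUC rY; lia.
Qed.

Lemma rank_free_notin x (X : {set T}) : r (x |: X) = (r X).+1 -> x \notin X.
Proof.
move=> rx; apply/negP => xX; move: rx; rewrite (setUidPr _) ?sub1set //; lia.
Qed.

Lemma indep_free x (X : {set T}) : r (x |: X) = (r X).+1 -> indep N (x |: X) = indep N X.
Proof. by move=> rx; rewrite !indepE cardsU1 rx (rank_free_notin rx) add1n eqSS. Qed.

(* Independence in a fan of the set of those a j with b j: the elements a 0 and a 1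
   are in series, and together they span what a 0 and a 2 span. *)
Fixpoint findep m b : bool :=
  if m is m'.+1 then
    findep m' (shift2 b) &&
    ((b 0 && b 1) ==> (~~ b 2 && findep m' (fun j => (j == 0) || shift2 b j)))
  else true.

(** Each rim element is dependent on the two spokes of its triangle, so the spokes span. *)
Lemma fanlike_rank m a : fanlike m a -> r (ielems m a predT) = r (ielems m a (fun j => ~~ odd j)).
Proof.
case=> inj sp le ri tr; set S := ielems m a (fun j => ~~ odd j).
have -> : ielems m a predT = S :|: ielems m a predT by apply/esym/setUidPr/ielems_sub.
apply: rank_span => x /ielemsP[j [jm _ ->]].
case oj: (odd j); last first.
  by rewrite (setUidPr _) // sub1set; apply/ielemsP; exists j; rewrite oj.
have [i ej] : exists i, j = (2 * i).+1 by exists j./2; rewrite -[LHS]odd_double_half oj; lia.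
have im : i < m by lia.
have sub : [set a (2 * i); a (2 * i).+2] \subset S.
  rewrite subUset !sub1set; apply/andP; split; apply/ielemsP.
    by exists (2 * i); rewrite oddM; split=> //; lia.
  by exists (2 * i).+2; rewrite /= oddM; split=> //; lia.
have r2 : r [set a (2 * i); a (2 * i).+2] = 2.
  have /eqP -> : r [set a (2 * i); a (2 * i).+2] == #|[set a (2 * i); a (2 * i).+2]|.
    by rewrite -indepE; apply: indepS sp.
  rewrite cards2; case: eqP => // /inj; lia.
have r3 : r [set a (2 * i); a (2 * i).+1; a (2 * i).+2] = 2.
  have ge : r [set a (2 * i); a (2 * i).+2] <= r [set a (2 * i); a (2 * i).+1; a (2 * i).+2].
    by apply: rankS; rewrite !subUset !sub1set !inE !eqxx !orbT.
  rewrite r2 in ge; apply/eqP; rewrite eqn_leq ge andbT.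
  have := tr i im; rewrite indepE => /negP n; have := rank_card N [set a (2 * i); a (2 * i).+1; a (2 * i).+2].
  rewrite leq_eqVlt => /orP[//|]; move/leq_trans; rewrite -ltnS; apply.
  have := leq_card_setU [set a (2 * i); a (2 * i).+1] [set a (2 * i).+2]; rewrite cards1 => /leq_trans; apply.
  by rewrite cards2; case: (_ != _).
have := @rank_same_span S [set a (2 * i); a (2 * i).+2] [set a (2 * i); a (2 * i).+1; a (2 * i).+2].
rewrite (setUidPl sub) r2 r3 => h; apply/eqP; rewrite eqn_leq; apply/andP; split; last by apply/rankS/subsetUr.
rewrite h //; last by rewrite !subUset !sub1set !inE !eqxx !orbT.
by apply: rankS; rewrite setUC setUS // sub1set ej !inE eqxx orbT.
Qed.

(** Induction on the fan [F] left after removing [a 0] and [a 1], neither of which is spanned by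
    [F]. If both are chosen, [a 1] is traded for [a 2], because any two elements of the first
    triangle span it. *)
Lemma findepP m a b : fanlike m a -> indep N (ielems m a b) = findep m b.
Proof.
elim: m a b => [|m IHm] a b fa.
  have := fan_spokes fa; apply: indepS; apply/subsetP => x /ielemsP[j [jm bj ->]].
  by apply/ielemsP; exists j; split=> //; move: jm; case: j {bj}.
have fa' := fanlikeS fa; case: fa => inj sp le ri tr.
set F := ielems m (shift2 a) predT; set J := ielems m (shift2 a) (shift2 b).
have sJF : J \subset F by apply: ielems_sub.
have a2F : a 2 \in F by apply/ielemsP; exists 0.
have nin i : i < 2 -> a i \notin F.
  move=> i2; apply/negP => /ielemsP[j [jm _ /inj]]; rewrite /shift2; lia.
have free0 : r (a 0 |: F) = (r F).+1.
  apply/eqP; rewrite eqn_leq; apply/andP; split.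
    by have := rankU_card N F [set a 0]; rewrite cards1 setUC addn1.
  rewrite /F (fanlike_rank fa'); set S := ielems m (shift2 a) (fun j => ~~ odd j).
  have iS : indep N (a 0 |: S).
    apply: indepS sp; rewrite ielemsS /= setU0 setUS //.
    by apply: ielems_sub => j; rewrite /shift2 /= negbK.
  rewrite (@leq_trans (r (a 0 |: S))) //; last by apply/rankS/setUS/ielems_sub.
  move: iS; rewrite indepE cardsU1 => /eqP->.
  rewrite (_ : a 0 \notin S); last by apply: contra (nin 0 isT); apply/subsetP/ielems_sub.
  by rewrite add1n ltnS rank_card.
set L := [set a 0; a 1; a 2].
have pair i j : i < j <= 2 -> r [set a i; a j] = 2.
  move=> /andP[ij j2]; suff /eqP-> : r [set a i; a j] == #|[set a i; a j]|.
    by rewrite cards2; case: eqP => // /inj; lia.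
  rewrite -indepE; case: j ij j2 => [|[|[|]]] // + _; case: i => [|[|]] // _.
  - exact: le 0 isT.
  - apply: indepS sp; rewrite subUset !sub1set; apply/andP; split; apply/ielemsP; [by exists 0 | by exists 2; split=> //; lia].
  exact: ri 0 isT.
have rL : r L = 2.
  have ge : r [set a 0; a 1] <= r L by apply/rankS/subsetUl.
  rewrite (pair 0 1 isT) in ge; apply/eqP; rewrite eqn_leq ge andbT.
  have := tr 0 isT; rewrite muln0 -/L indepE => /negP n; have := rank_card N L.
  rewrite leq_eqVlt => /orP[//|]; move/leq_trans; rewrite -ltnS; apply.
  have := leq_card_setU [set a 0; a 1] [set a 2]; rewrite cards1 => /leq_trans; apply.
  by rewrite cards2; case: (_ != _).
have inL i : i <= 2 -> a i \in L by case: i => [|[|[|]]] //; rewrite !inE eqxx ?orbT.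
have line i j X : i < j <= 2 -> r (X :|: [set a i; a j]) = r (X :|: L).
  move=> ij; apply: rank_same_span; last by rewrite pair.
  by rewrite subUset !sub1set !inL //; lia.
(* Since [F] contains [a 2], adding [a 0] or [a 1] to it gives the same span. *)
have free1 : r (a 1 |: F) = (r F).+1.
  apply/eqP; rewrite eqn_leq; apply/andP; split.
    by have := rankU_card N F [set a 1]; rewrite cards1 setUC addn1.
  have -> : a 1 |: F = F :|: [set a 1; a 2].
    by rewrite setUC -{1}(setUidPl (_ : [set a 2] \subset F)) ?sub1set // -setUA (setUC [set a 2]).
  rewrite line // -free0; apply: rankS; rewrite subUset sub1set subsetUl andbT.
  by rewrite in_setU inL // orbT.
rewrite ielemsS -/J /= -(IHm _ _ fa') -/J.
have f0 (X : {set T}) : X \subset F -> r (a 0 |: X) = (r X).+1 by move=> s; apply: rank_free_sub s free0.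
have f1 : r (a 1 |: J) = (r J).+1 by apply: rank_free_sub sJF free1.
case b0: (b 0); case b1: (b 1); rewrite /= ?set0U ?setU0 ?andbT; last by [].
- rewrite -(IHm _ _ fa') -ielems_add0 -/J.
  have -> : shift2 a 0 = a 2 by [].
  have a2J : (a 2 \in J) = b 2.
    apply/ielemsP/idP => [[j [jm bj /inj]]|b2]; last by exists 0.
    by move=> e; have -> : 2 = j.+2 by apply: e; lia.
  have rr : r ([set a 0] :|: [set a 1] :|: J) = (r (a 2 |: J)).+1.
    rewrite setUC line // -(line 0 2) //.
    have -> : J :|: [set a 0; a 2] = a 0 |: (a 2 |: J) by rewrite setUC setUA.
    by apply: f0; rewrite subUset sub1set a2F.
  have cc : #|[set a 0] :|: [set a 1] :|: J| = #|J|.+2.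
    rewrite -setUA !cardsU1 in_setU1 negb_or.
    rewrite (rank_free_notin f1) (rank_free_notin (f0 _ sJF)) andbT.
    by case: eqP => // /inj; lia.
  rewrite !indepE rr cc eqSS cardsU1 a2J; case b2: (b 2) => /=.
    rewrite andbF; apply/negbTE; rewrite (setUidPr _) ?sub1set ?a2J //.
    by have := rank_card N J; lia.
  rewrite add1n; case: (eqVneq (r (a 2 |: J)) #|J|.+1) => [e|]; rewrite ?andbF // andbT; apply/esym.
  have := rankU_card N J [set a 2]; rewrite cards1 setUC e; have := rank_card N J; lia.
- by apply: indep_free; apply: f0.
by apply: indep_free.
Qed.

End FanSets.

(** Independence on both sides is computed by [findep] from indices alone, so [a j] can be sent to
    [e j]. *)
Lemma fanlike_iso (T U : finType) (M : matroid T) (N : matroid U) m (a : nat -> T) (e : nat -> U) :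
  fanlike M m a -> fanlike N m e -> ground M = ielems m a predT -> ground N = ielems m e predT ->
  matroid_iso M N.
Proof.
move=> fa fe gM gN; have [inja _ _ _ _] := fa; have [inje _ _ _ _] := fe.
pose s := [seq a j | j <- iota 0 (2 * m).+1].
have fE j : j <= 2 * m -> index (a j) s = j.
  move=> jm; have sz : j < size s by rewrite size_map size_iota.
  have ej : nth (a j) s j = a j by rewrite (nth_map 0) ?size_iota // nth_iota.
  rewrite -{1}ej index_uniq //.
  rewrite map_inj_in_uniq ?iota_uniq // => i k; rewrite !mem_iota /= => im km; apply: inja; lia.
pose f x := e (index x s); exists f.
have fa_e j : j <= 2 * m -> f (a j) = e j by move=> jm; rewrite /f fE.
have im b : f @: ielems m a b = ielems m e b.
  apply/setP => y; apply/imsetP/ielemsP => [[x /ielemsP[j [jm bj ->]] ->]|[j [jm bj ->]]].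
    by exists j; rewrite fa_e.
  by exists (a j); rewrite ?fa_e //; apply/ielemsP; exists j.
split; first 1 last.
- by rewrite gM im gN.
- move=> I; rewrite gM => sI.
  have -> : I = ielems m a (fun j => a j \in I).
    apply/setP => x; apply/idP/ielemsP => [xI|[j [_ aI ->]]] //.
    by have /ielemsP[j [jm _ ex]] := subsetP sI x xI; exists j; rewrite -ex.
  by rewrite im !findepP.
move=> x y; rewrite gM => /ielemsP[i [im' _ ->]] /ielemsP[j [jm _ ->]].
by rewrite !fa_e // => /inje->.
Qed.

(** * The cycle matroid of a fan *)

Section Fan.
Variable m : nat.
Local Notation vt := (option 'I_m.+1).

Definition rimv (i : nat) : vt := Some (inord i).
(** Spokes and rim edges alternate, so that three consecutive edges beginning with a spoke form a
    triangle. *)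
Definition fan_edge (j : nat) : {set vt} :=
  if odd j then [set rimv j./2; rimv j./2.+1] else [set None; rimv j./2].

Lemma fan_edgeE i : fan_edge (2 * i) = [set None; rimv i].
Proof. by rewrite /fan_edge mul2n odd_double doubleK. Qed.

Lemma fan_edgeO i : fan_edge (2 * i).+1 = [set rimv i; rimv i.+1].
Proof. by rewrite /fan_edge /= mul2n odd_double /= uphalf_double. Qed.

Lemma rimv_inj i j : i <= m -> j <= m -> rimv i = rimv j -> i = j.
Proof. by move=> im jm [/(congr1 val)]; rewrite /= !inordK. Qed.

Lemma parity j : (exists2 i, j = 2 * i & ~~ odd j) \/ (exists2 i, j = (2 * i).+1 & odd j).
Proof.
case oj: (odd j); [right|left]; exists j./2; rewrite ?oj // -[LHS]odd_double_half oj; lia.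
Qed.

Lemma fan_edge_in j : j <= 2 * m -> fan_edge j \in edges (fan m.+1).
Proof.
move=> jm; have [[i ej _]|[i ej _]] := parity j; rewrite ej ?fan_edgeE ?fan_edgeO; apply/edgesP.
  by exists None, (rimv i).
exists (rimv i), (rimv i.+1); split=> //=.
by rewrite /fan_adj /path_adj /= !inordK ?eqxx //; lia.
Qed.

Lemma fan_edges : edges (fan m.+1) = ielems m fan_edge predT.
Proof.
have vE (i : 'I_m.+1) : Some i = rimv i by rewrite /rimv inord_val.
apply/setP => x; apply/edgesP/ielemsP => [[u [v [auv ->]]]|[j [jm _ ->]]]; last first.
  by apply/edgesP/fan_edge_in.
case: u v auv => [i|] [j|] //=; rewrite /fan_adj /path_adj /= => auv.
- have key (k l : 'I_m.+1) : l = k.+1 :> nat -> exists j0, [/\ j0 <= 2 * m, predT j0 & [set Some k; Some l] = fan_edge j0].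
    move=> lk; exists (2 * k).+1; rewrite fan_edgeO !vE lk; split=> //.
    by have := ltn_ord l; rewrite lk; lia.
  case/orP: auv => /eqP h; first exact: key.
  by rewrite setUC; apply: key.
- by exists (2 * i); rewrite fan_edgeE vE setUC; split=> //; have := ltn_ord i; lia.
by exists (2 * j); rewrite fan_edgeE vE; split=> //; have := ltn_ord j; lia.
Qed.

Lemma spokes_forest : @forest (fan m.+1) (ielems m fan_edge (fun j => ~~ odd j)).
Proof.
apply/andP; split; first by rewrite fan_edges ielems_sub.
apply/asboolP; have [_ _ ac] := full_star_tree 'I_m.+1.
apply: acyclic_sub ac => x y /ielemsP[j [jm]].
have [[i -> _] _|[i -> oj]] := parity j; last by rewrite oj.
by rewrite fan_edgeE => /set2_eq[[-> ->]|[-> ->]].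
Qed.

Lemma forest_add_isolated (G : sgraph) (X : {set {set G}}) (x y : G) :
  forest X -> adj x y -> (forall z, [set x; z] \notin X) -> forest ([set x; y] |: X).
Proof.
case/andP => sX /asboolP acX axy iso; apply/andP; split.
  by rewrite subUset sX sub1set edges_adj axy.
apply/asboolP/acyclic_add => //; apply/connectP => -[[|z p]] /=.
  by move=> _ e; rewrite e adj_irr in axy.
by case/andP => e _ _; move: e; rewrite /spanning_adj /= (negPf (iso z)).
Qed.

Lemma fan_fanlike : fanlike (cycle_matroid (fan m.+1)) m fan_edge.
Proof.
have spoke i : i <= m -> @forest (fan m.+1) [set fan_edge (2 * i)].
  move=> im; apply: forestS spokes_forest; rewrite sub1set; apply/ielemsP.
  by exists (2 * i); rewrite oddM; split=> //; lia.
have rimN (u v : vt) i : [set None; u] = [set rimv i; v] -> v = None /\ u = rimv i.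
  by case/set2_eq => [[]|[->->]].
have adjr i : i < m -> @adj (fan m.+1) (rimv i) (rimv i.+1).
  by move=> im; rewrite /= /fan_adj /path_adj /= !inordK ?eqxx //; lia.
split.
- move=> i j im jm; have [[i' ei _]|[i' ei _]] := parity i; have [[j' ej _]|[j' ej _]] := parity j; subst i j.
  + rewrite !fan_edgeE => /set2_eq[[_ /rimv_inj]|[//]]; lia.
  + by rewrite fan_edgeE fan_edgeO => /set2_eq[[]|[]].
  + by rewrite fan_edgeE fan_edgeO => /esym/set2_eq[[]|[]].
  rewrite !fan_edgeO => /set2_eq[[/rimv_inj]|[/rimv_inj h1 /rimv_inj h2]]; first by lia.
  by have := h1; have := h2; lia.
- exact: spokes_forest.
- move=> i im; rewrite setUC fan_edgeO (setUC [set rimv i]).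
  apply: forest_add_isolated; first by apply: spoke; lia.
    by rewrite adj_sym adjr.
  move=> z; rewrite inE fan_edgeE; apply/eqP => /esym/rimN[_ /rimv_inj]; lia.
- move=> i im; rewrite fan_edgeO (_ : (2 * i).+2 = 2 * i.+1); last by rewrite mulnS.
  apply: forest_add_isolated; [by apply: spoke; lia | exact: adjr |].
  move=> z; rewrite inE fan_edgeE; apply/eqP => /esym/rimN[_ /rimv_inj]; lia.
move=> i im; apply/negP => /andP[_ /asboolP ac].
have /ac : ucycle (@spanning_adj (fan m.+1) [set fan_edge (2 * i); fan_edge (2 * i).+1; fan_edge (2 * i).+2])
    [:: None; rimv i; rimv i.+1]; last by [].
rewrite /ucycle /spanning_adj /= !inE fan_edgeE fan_edgeO.
rewrite (_ : fan_edge (2 * i).+2 = [set None; rimv i.+1]); last by rewrite -fan_edgeE mulnS.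
rewrite !eqxx (setUC [set rimv i.+1] [set None]) eqxx !orbT /= andbT.
by apply/negP => /eqP/rimv_inj; lia.
Qed.

End Fan.

(** * From an induced path to a fan minor, and the final count *)

Lemma ipath_nth (T : eqType) (e : rel T) x0 s i j : ipath e s -> i < j < size s ->
  e (nth x0 s i) (nth x0 s j) = (j == i.+1).
Proof.
elim: s i j => [|x s IHs] i j //=; first by rewrite ltn0 andbF.
case/and3P => ips xs h; case: j => [|j]; first by rewrite ltn0.
case: i => [|i]; last by rewrite /= !ltnS eqSS; apply: IHs.
rewrite ltnS eqSS /=; case: s {IHs xs ips} h => [|y s] //= /andP[exy /allP h].
case: j => [|j] //=; rewrite ltnS => js; apply/negbTE/h; exact: mem_nth.
Qed.

Lemma ipath_uniq (T : eqType) (e : rel T) s : ipath e s -> uniq s.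
Proof. by elim: s => //= x s IHs /and3P[/IHs-> ->]. Qed.

(** Dropping the first element if necessary, the path starts in [B]; its elements in [B] are the
    spokes, the others the rim. Contracting the rest of [B] and deleting all else off the path makes
    independence of [I] in the minor equivalent to that of [C :|: I] in [M]. *)
Lemma ipath_minor (T : finType) (M : matroid T) B s m :
  base M B -> ipath (fadj M B) s -> 2 * m.+1 <= size s -> has_minor M (cycle_matroid (fan m.+1)).
Proof.
move=> bB ips szs.
have [x0 [l [ipl szl l0]]] : exists x0 l, [/\ ipath (fadj M B) l, size l = (2 * m).+1 & nth x0 l 0 \in B].
  case: s ips szs => [|x [|y s]] ips szs; try by move: szs => /=; lia.
  exists x; case xB: (x \in B).
    exists (take (2 * m).+1 [:: x, y & s]); split; [exact: ipath_take | | by []].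
    by rewrite size_takel //; move: szs => /=; lia.
  exists (take (2 * m).+1 (y :: s)); split; [by apply: ipath_take; case/andP: ips | |].
    by rewrite size_takel //; move: szs => /=; lia.
  by case/and3P: ips => _ _ /andP[/fadj_alt]; rewrite xB /=; case: (y \in B).
pose a j := nth x0 l j.
have adjE i j : i < j <= 2 * m -> fadj M B (a i) (a j) = (j == i.+1).
  by move=> ij; apply: ipath_nth ipl _; rewrite szl ltnS.
have aB j : j <= 2 * m -> (a j \in B) = ~~ odd j.
  elim: j => [|j IHj] jm; first by rewrite /a l0.
  have : fadj M B (a j) (a j.+1) by rewrite adjE ?eqxx // ltnSn.
  by move/fadj_alt; rewrite IHj 1?ltnW //= => ->; rewrite negbK.
have inja i j : i <= 2 * m -> j <= 2 * m -> a i = a j -> i = j.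
  by move=> im jm /eqP; rewrite nth_uniq ?szl ?ltnS ?(ipath_uniq ipl) // => /eqP.
have aE j : j <= 2 * m -> a j \in ground M.
  move=> jm; case oj: (odd j); last by apply: (subsetP (base_sub bB)); rewrite aB ?oj.
  have : fadj M B (a j.-1) (a j) by rewrite adjE; lia.
  by rewrite fadj_sym; apply: fadj_ground.
set l' := ielems m a predT.
have sl'E : l' \subset ground M by apply/subsetP => x /ielemsP[j [jm _ ->]]; apply: aE.
pose C := B :\: l'; pose D := ground M :\: (B :|: l').
have sCE : C \subset ground M by apply: subset_trans (subsetDl _ _) (base_sub bB).
have gN : ground (delete (contract M C) D) = l'.
  apply/setP => x; rewrite /= /C /D !in_setD !in_setU.
  case: (boolP (x \in l')) => xl /=; first by rewrite orbT (subsetP sl'E).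
  by rewrite orbF; case: (x \in B); rewrite ?andbF //= andNb.
have iC : indep M C by apply: indepS (base_indep bB); apply: subsetDl.
have iN (I : {set T}) : I \subset l' -> indep (delete (contract M C) D) I = indep M (C :|: I).
  move=> sI; rewrite /= /delete_indep /=.
  have rC : #|C| = rank M C by apply/esym/eqP; rewrite -indepE.
  have := contract_indepE I (subxx C) iC rC; rewrite /contract_indep /= => ->.
  have -> : [disjoint I & D].
    by apply/pred0P => x /=; apply/negP => /andP[/(subsetP sI) xl]; rewrite in_setD in_setU xl orbT.
  rewrite andbT; suff -> : I \subset ground M :\: C by [].
  apply/subsetP => x /(subsetP sI) xl; by rewrite !in_setD xl (subsetP sl'E).
exists C, D; split=> //; first exact: subsetDl.
  by apply/pred0P => x /=; apply/negP; rewrite !in_setD in_setU => /andP[/andP[_ ->]].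
apply: (fanlike_iso _ (fan_fanlike m) gN (fan_edges m)).
have al j : j <= 2 * m -> a j \in l' by move=> jm; apply/ielemsP; exists j.
have naC j : j <= 2 * m -> a j \notin C by move=> jm; rewrite in_setD al.
(* Exchanging a rim element with one of the two spokes next to it yields a base that contains it
   together with the other spoke. *)
have swapped i k : i < m -> k = 2 * i \/ k = (2 * i).+2 -> base M (a (2 * i).+1 |: B :\ a k).
  move=> im hk; have : fadj M B (a (2 * i).+1) (a k).
    by case: hk => ->; [rewrite fadj_sym|]; rewrite adjE ?eqxx //; lia.
  rewrite fadjC; first by case/and4P.
  by rewrite aB ?negbK /= ?oddM //; lia.
have hC i k : k <= 2 * m -> C \subset a (2 * i).+1 |: B :\ a k.
  by move=> km; apply: subset_trans (subsetUr _ _); rewrite subsetD1 subsetDl naC.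
split=> //.
- rewrite iN; last exact: ielems_sub.
  apply: indepS (base_indep bB); rewrite subUset subsetDl /=.
  by apply/subsetP => x /ielemsP[j [jm oj ->]]; rewrite aB.
- move=> i im; rewrite iN; last by rewrite subUset !sub1set !al //; lia.
  apply: indepS (base_indep (swapped i (2 * i).+2 im _)); last by right.
  rewrite subUset hC /=; last by lia.
  rewrite subUset !sub1set !in_setU1 !in_setD1 eqxx andbT; apply/orP; right.
  rewrite aB ?oddM; last by lia.
  by rewrite andbT; apply/eqP => /inja; lia.
- move=> i im; rewrite iN; last by rewrite subUset !sub1set !al //; lia.
  apply: indepS (base_indep (swapped i (2 * i) im _)); last by left.
  rewrite subUset hC /=; last by lia.
  rewrite subUset !sub1set !in_setU1 !in_setD1 eqxx /=; apply/orP; right.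
  rewrite aB /= ?oddM; last by lia.
  by rewrite andbT; apply/eqP => /inja; lia.
move=> i im; rewrite iN; last by rewrite !subUset !sub1set !al //; lia.
set F := C :|: [set a (2 * i); a (2 * i).+2].
have -> : C :|: [set a (2 * i); a (2 * i).+1; a (2 * i).+2] = a (2 * i).+1 |: F.
  apply/setP => x; rewrite /F !(in_setU, in_set1).
  by case: (x \in C); case: (x == a (2 * i)); case: (x == a (2 * i).+1).
(* As the path is induced, the only neighbours on it of the rim element are the two adjacent spokes,
   so its fundamental circuit stays within the set considered. *)
rewrite (fadj_span bB).
- apply/existsP => -[y /andP[/setDP[yB yF]]].
  have : y \in l'.
    by apply: contraR yF => yl; rewrite !in_setU in_setD yl yB.
  case/ielemsP => j [jm _ ey]; rewrite {}ey in yB yF *; rewrite aB // in yB.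
  have j1 : j <> 2 * i by move=> e; rewrite e !inE eqxx ?orbT in yF.
  have j2 : j <> (2 * i).+2 by move=> e; rewrite e !inE eqxx ?orbT in yF.
  apply/negP; case: (ltngtP j (2 * i).+1) => [lt|gt|ej]; last by rewrite ej /= oddM in yB.
    by rewrite fadj_sym adjE; lia.
  by rewrite adjE; lia.
- rewrite subUset subsetDl subUset !sub1set !aB /= ?oddM //; lia.
- by apply: aE; lia.
by rewrite aB /= ?oddM //; lia.
Qed.

Theorem theorem1p2 (n w : nat) (T : finType) (M : matroid T) :
  0 < n -> 0 < w -> 3 * (3 * w) ^ (2 * n) <= branch_depth M ->
  has_minor M (cycle_matroid (fan n)) \/ w < branch_width M.
Proof.
case: n => // m _ w0; set D := 3 * _ => leD.
case: (ltnP w (branch_width M)) => [|bw]; [by right|left].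
(* With [n = m.+1] the bound is [9 * (w * x)], where [x] is at least the number
   [(2 * w) ^ (2 * m).+1] of rounds. It pays for three levels of depth and [w] in connectivity per
   round, plus the small losses at the start. *)
set x := (3 * w) ^ (2 * m).+1; have x3 : 3 <= x.
  by apply: (@leq_trans ((3 * w) ^ 1)); [rewrite expn1; lia | rewrite leq_pexp2l //; lia].
have DE : D = 9 * (w * x) by rewrite /D mulnS expnS -/x; lia.
have wx : x <= w * x by rewrite leq_pmull.
have M1 : 1 < #|ground M|.
  by move: leD; rewrite /branch_depth; case: ltnP => // _; rewrite DE; lia.
have [G [sigma [[tG dG lG] eG]]] := branch_width_attained M1.
have bE : bdec M w (ground M).
  by apply: (branch_bdec tG dG lG) => //; rewrite eG.
(* [K] bounds both width and height: since the branch-depth exceeds it, the ground set has no rooted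
   decomposition with these bounds. *)
pose K := D.-1; have K0 : 0 < K by rewrite /K; lia.
have nE : ~ dec M K K (ground M).
  move=> /(dec_decomposition K0 M1)[d dK [G' [s [h1 h2 h3]]]].
  have : branch_depth M <= K.
    rewrite /branch_depth M1; set P := (P in least P).
    have hP : P K by exists G', s; split=> //; apply: leq_trans h3 dK.
    by have [|_] := @leastP P; [exists K | apply].
  by rewrite /K; lia.
have [B bB] := base_exists M.
have [c cE] : exists c, c \in ground M by apply/card_gt0P/ltnW.
have lE : (lambda M (ground M)).+2 <= K by rewrite lambda_ground /K; lia.
have nE' : ~ dec M K K.-1.+1 (ground M) by rewrite prednK.
(* [M] may be disconnected, so the process starts from a deep component after removing one
   element. *)
have [y yE nC] := big_component K0 c bB (subxx _) lE nE'.
set C := component M B (ground M :\ c) y in nC.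
have lC : lambda M C <= 1.
  apply: leq_trans (lambda_separated bB (subsetDl _ _) (component_sub _ _ _ _) (@component_separated _ _ _ _ _)) _.
  apply: leq_trans (lambdaD_le _ (subxx _)) _; rewrite lambda_ground add0n.
  by apply: leq_trans (lambda_card _ _) _; rewrite cards1.
have decle d d' : d <= d' -> dec M K d C -> dec M K d' C.
  elim: d' => [|d' IH]; first by rewrite leqn0 => /eqP->.
  rewrite leq_eqVlt => /orP[/eqP->//|]; rewrite ltnS => /IH h /h; apply: decS => //.
  by apply: leq_trans lC _; lia.
have le23 : (2 * w) ^ (2 * m).+1 <= x by rewrite /x leq_exp2r //; lia.
have st : state M B C [::].
  split=> //; first exact: subset_trans (component_sub _ _ _ _) (subsetDl _ _).
  exact: component_connected.
(* For [k = 2 * m] the resulting stick has a port and at least [2 * m + 1] further elements, hence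
   at least [2 * n] in all. *)
have [||||B' [s [bB' ips szs]]] := @run _ M w w0 K (2 * m) ((2 * w) ^ (2 * m).+1) B C [::] bE st.
- move=> h; apply: nC; apply: decle h; rewrite /K; lia.
- have : w * (2 * w) ^ (2 * m).+1 <= w * x by rewrite leq_pmul2l.
  by rewrite /K; lia.
- by rewrite /=; lia.
- by rewrite leq_addl.
by apply: (ipath_minor bB' ips); rewrite /=; lia.
Qed.
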